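(* Let $\sigma\colon\Sigma^+\to\Sigma^+$ be the left shift on $\Sigma^+=\{0,1\}^{\mathbb N}$. Let $\theta\in(0,1/4)$ and let $\boldsymbol a=\{a_n\}_{n\in\mathbb N_0}$ be a strictly decreasing sequence of positive numbers satisfying $$\frac{a_{n+1}}{a_n}=O(\theta^n)\qquad\text{as } n\to+\infty .$$ Let $\mathcal{PU}(\sigma)$ be the set of continuous functions $f\colon\Sigma^+\to\mathbb R$ such that there is a unique $f$-maximizing measure $\mu$ and $\mu$ is supported on a periodic orbit of $\sigma$. Then $\mathcal{PU}(\sigma)\cap \mathrm{Lip}(\Sigma^+,d_{\boldsymbol a})$ is a prevalent set in the space $\mathrm{Lip}(\Sigma^+,d_{\boldsymbol a})$ of real-valued Lipschitz functions. Moreover, $\mathrm{Lock}_\sigma(\Sigma^+,d_{\boldsymbol a})$ is a prevalent set in $\mathrm{Lip}(\Sigma^+,d_{\boldsymbol a})$.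
   Context: Here $\mathbb N=\{1,2,3,\dots\}$ and $\mathbb N_0=\{0\}\cup\mathbb N$. The left shift is $\sigma(\{w_i\}_{i\in\mathbb N})=\{w_{i+1}\}_{i\in\mathbb N}$. Metric: for a strictly decreasing sequence $\boldsymbol a=\{a_n\}_{n\in\mathbb N_0}$ of positive numbers converging to $0$, $d_{\boldsymbol a}(\boldsymbol w,\boldsymbol z)=a_m$ for distinct $\boldsymbol w=\{w_n\},\boldsymbol z=\{z_n\}\in\Sigma^+$, where $m$ is the smallest positive integer with $w_m\ne z_m$, and $d_{\boldsymbol a}(\boldsymbol z,\boldsymbol z)=0$. Lipschitz space: $\mathrm{Lip}(\Sigma^+,d_{\boldsymbol a})$ is the Banach space of real-valued Lipschitz functions on $(\Sigma^+,d_{\boldsymbol a})$ with norm $\|f\|_{\mathrm{Lip}}=\|f\|_\infty+\mathrm{LIP}_{d_{\boldsymbol a}}(f)$, where $\mathrm{LIP}_{d_{\boldsymbol a}}(f)=\sup\{|f(x)-f(y)|/d_{\boldsymbol a}(x,y): x\neq y\}$. Maximizing measures: for continuous $f\colon\Sigma^+\to\mathbb R$, an $f$-maximizing measure is a $\sigma$-invariant Borel probability measure $\mu$ on $\Sigma^+$ with $\int f\,d\mu=\max_{\nu}\int f\,d\nu$, the maximum being over all $\sigma$-invariant Borel probability measures $\nu$. Locking: $\mathrm{Lock}_\sigma(\Sigma^+,d_{\boldsymbol a})$ is the set of $f\in\mathrm{Lip}(\Sigma^+,d_{\boldsymbol a})$ having a unique maximizing measure $\nu$, with $\nu$ supported on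 a periodic orbit of $\sigma$, and such that $\nu$ is the unique maximizing measure of every function in $\mathrm{Lip}(\Sigma^+,d_{\boldsymbol a})$ sufficiently close to $f$ in the norm $\|\cdot\|_{\mathrm{Lip}}$. Prevalence: let $V$ be a real topological vector space equipped with a complete metric. A Borel measure $\mu$ on $V$ is transverse to a Borel set $B\subseteq V$ if $\mu(\{x+v: x\in B\})=0$ for every $v\in V$. A Borel set $B\subseteq V$ is shy if there is a compactly supported Borel probability measure transverse to $B$. A subset $S\subseteq V$ is prevalent if $V\setminus S$ is contained in a shy Borel subset of $V$. *)

(* Defs.v *)
From HB Require Import structures.
From mathcomp Require Import all_boot all_order all_algebra.
From mathcomp Require Import ring.
From mathcomp Require Import all_classical all_reals all_analysis.

Set Implicit Arguments.
Unset Strict Implicit.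
Unset Printing Implicit Defensive.

Import Order.TTheory GRing.Theory Num.Theory.
Import numFieldNormedType.Exports.

Local Open Scope classical_set_scope.
Local Open Scope ring_scope.

Definition borel (T : ptopologicalType) := g_sigma_algebraType (@open T).

(* Prevalence depends only on the topological vector space structure; it is
   stated for Banach spaces, the only case needed. *)
Section prevalence.
Context {R : realType} {V : completeNormedModType R}.

Definition compactly_supported (mu : probability (borel V) R) : Prop :=
  exists K : set V, compact K /\ mu (~` K) = 0%E.

Definition transverse (mu : probability (borel V) R) (B : set V) : Prop :=
  forall v : V, mu [set x + v | x in B] = 0%E.

Definition shy (B : set (borel V)) : Prop :=
  measurable B /\ exists mu, compactly_supported mu /\ transverse mu B.

Definition prevalent (S : set V) : Prop := exists B, shy B /\ ~` S `<=` B.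

End prevalence.

Section maximizing_measures.
Context {R : realType} {X : ptopologicalType} (T : X -> X).
Implicit Types (f : X -> R) (mu nu : probability (borel X) R).

Definition invariant_measure mu : Prop :=
  forall A : set (borel X), measurable A -> mu (T @^-1` A) = mu A.

Definition maximizing f mu : Prop :=
  invariant_measure mu /\
  forall nu, invariant_measure nu -> (\int[nu]_x (f x)%:E <= \int[mu]_x (f x)%:E)%E.

(* A [probability] is a function on all subsets, so that two Borel measures
   are identified when they agree on the measurable sets. *)
Definition unique_maximizing f mu : Prop :=
  maximizing f mu /\
  forall nu, maximizing f nu ->
    forall A : set (borel X), measurable A -> nu A = mu A.

Definition supported_on_periodic_orbit mu : Prop :=
  exists (x : X) (p : nat),
    [/\ (0 < p)%N, iter p T x = x & mu (~` range (fun n => iter n T x)) = 0%E].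

Definition PU : set (X -> R) :=
  [set f | continuous f /\
    exists mu, unique_maximizing f mu /\ supported_on_periodic_orbit mu].

End maximizing_measures.

(* The sequence (w_1, w_2, ...) is represented by the function i |-> w_(i+1),
   with i ranging over nat. *)
Definition Sigma : ptopologicalType := cantor_space.

Definition sigma (w : Sigma) : Sigma := fun i => w i.+1.

Lemma Sigma_neqP (w z : Sigma) : w != z -> exists i, w i != z i.
Proof.
move=> wz; apply: contrapT => h; move/eqP: wz; apply.
by apply/funext => i; apply: contrapT => wzi; apply: h; exists i; apply/eqP.
Qed.

Definition zeros : Sigma := fun=> false.

Definition ones : Sigma := fun=> true.

Lemma zeros_neq_ones : zeros != ones.
Proof. by apply/eqP => /(congr1 (fun w : Sigma => w 0%N)). Qed.

(* Convergence to 0, which makes [dist] below induce the product topology, is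
   not included: it is implied by a_(n+1) / a_n = O(theta^n) for theta < 1. *)
Record decr_seq (R : realType) := DecrSeq {
  seq_of :> nat -> R;
  seq_of_gt0 : forall n, 0 < seq_of n;
  seq_of_decr : forall n, seq_of n.+1 < seq_of n }.

Section dist.
Context {R : realType} (a : decr_seq R).

(* The first disagreement at the 0-based index i is w_(i+1) <> z_(i+1). *)
Definition dist (w z : Sigma) : R :=
  if pselect (exists i, w i != z i) is left h then a (ex_minn h).+1 else 0.

Lemma dist_gt0 w z : w != z -> 0 < dist w z.
Proof.
by move=> /Sigma_neqP h; rewrite /dist; case: pselect => // ?; exact: seq_of_gt0.
Qed.

Lemma distxx w : dist w w = 0.
Proof.
by rewrite /dist; case: pselect => // h; exfalso; case: h => i; rewrite eqxx.
Qed.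

Lemma seq_of_le n : a n <= a 0.
Proof.
elim: n => // n; apply: le_trans; exact/ltW/seq_of_decr.
Qed.

Lemma dist_le w z : dist w z <= a 0.
Proof.
rewrite /dist; case: pselect => [h|_]; first exact: seq_of_le.
exact/ltW/seq_of_gt0.
Qed.

Definition lip_pred : {pred Sigma -> R} :=
  mem [set f : Sigma -> R |
    exists C, forall x y, `|f x - f y| <= C * dist x y].

Lemma lip_predP f : reflect (exists C, forall x y, `|f x - f y| <= C * dist x y)
  (f \in lip_pred).
Proof. exact/asboolP. Qed.

Lemma lip_submod_closed : submod_closed lip_pred.
Proof.
split.
  by apply/lip_predP; exists 0 => x y; rewrite subrr normr0 mul0r.
move=> c f g /lip_predP[C hC] /lip_predP[D hD]; apply/lip_predP.
exists (`|c| * C + D) => x y.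
rewrite [X in `|X|](_ : _ = c * (f x - f y) + (g x - g y)); last first.
  by rewrite mulrBr addrACA -opprD.
rewrite (le_trans (ler_normD _ _))// mulrDl lerD// normrM -mulrA.
by rewrite ler_wpM2l.
Qed.

HB.instance Definition _ :=
  GRing.isSubmodClosed.Build R (Sigma -> R) lip_pred lip_submod_closed.

Record Lip := MkLip { lip_val :> Sigma -> R; lip_valP : lip_val \in lip_pred }.

HB.instance Definition _ := [isSub for lip_val].
HB.instance Definition _ := [Choice of Lip by <:].
HB.instance Definition _ := [SubChoice_isSubLmodule of Lip by <:].


Lemma lipP (f : Lip) : exists2 C, 0 <= C &
  forall x y, `|f x - f y| <= C * dist x y.
Proof.
have /lip_predP[C hC] := lip_valP f; exists `|C| => // x y.
rewrite (le_trans (hC x y))// ler_wpM2r ?ler_norm//.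
have [->|xy] := eqVneq x y; first by rewrite distxx.
exact/ltW/dist_gt0.
Qed.

Lemma lipD (f g : Lip) x : (f + g) x = f x + g x. Proof. by []. Qed.

Lemma lipB (f g : Lip) x : (f - g) x = f x - g x. Proof. by []. Qed.

Lemma lipZ (c : R) (f : Lip) x : (c *: f) x = c * f x. Proof. by []. Qed.

Lemma lip_ext (f g : Lip) : (forall x, f x = g x) -> f = g.
Proof. by move=> fg; apply/val_inj/funext. Qed.

Definition sup_norm (f : Lip) : R := sup (range (fun x => `|f x|)).

Definition lip_quotients (f : Lip) : set R :=
  [set r | exists x y, x != y /\ r = `|f x - f y| / dist x y].

Definition lip_const (f : Lip) : R := sup (lip_quotients f).

Definition lip_norm (f : Lip) : R := sup_norm f + lip_const f.

Implicit Types f g : Lip.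

Lemma has_sup_norm f : has_sup (range (fun x => `|f x|)).
Proof.
split; first by exists `|f zeros|, zeros.
have [C C0 hC] := lipP f; exists (`|f zeros| + C * a 0%N) => _ [x _ <-].
rewrite -[f x](subrK (f zeros)) addrC (le_trans (ler_normD _ _))// lerD//.
by rewrite (le_trans (hC _ _))// ler_wpM2l// dist_le.
Qed.

Lemma has_sup_lip f : has_sup (lip_quotients f).
Proof.
split.
  exists (`|f zeros - f ones| / dist zeros ones), zeros, ones; split=> //.
  exact: zeros_neq_ones.
have [C C0 hC] := lipP f; exists C => _ [x [y [xy ->]]].
by rewrite ler_pdivrMr ?dist_gt0.
Qed.

Lemma lip_norm_leP f e : lip_norm f <= e <->
  forall x y z, y != z -> `|f x| + `|f y - f z| / dist y z <= e.
Proof.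
split=> [fe x y z yz|h].
  apply: le_trans fe; apply: lerD; apply: ub_le_sup.
  - by have [] := has_sup_norm f.
  - by exists x.
  - by have [] := has_sup_lip f.
  - by exists y, z.
rewrite /lip_norm -lerBrDr; apply: ge_sup; first by have [] := has_sup_norm f.
move=> _ [x _ <-]; rewrite lerBrDr -lerBrDl.
apply: ge_sup; first by have [] := has_sup_lip f.
by move=> _ [y [z [yz ->]]]; rewrite lerBrDl; exact: h.
Qed.

Lemma lip_norm_ge f x y z : y != z ->
  `|f x| + `|f y - f z| / dist y z <= lip_norm f.
Proof. by move: x y z; apply/lip_norm_leP. Qed.

Lemma lip_norm_eval f x : `|f x| <= lip_norm f.
Proof.
apply: le_trans (lip_norm_ge f x zeros_neq_ones).
by rewrite lerDl divr_ge0// ltW// dist_gt0 ?zeros_neq_ones.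
Qed.

Lemma lip_normD f g : lip_norm (f + g) <= lip_norm f + lip_norm g.
Proof.
apply/lip_norm_leP => x y z yz.
apply: le_trans (lerD (lip_norm_ge f x yz) (lip_norm_ge g x yz)).
rewrite addrACA lerD ?lipD ?ler_normD// -mulrDl ler_pM2r ?invr_gt0 ?dist_gt0//.
by rewrite opprD addrACA ler_normD.
Qed.

Lemma lip_normZ_le c f : lip_norm (c *: f) <= `|c| * lip_norm f.
Proof.
apply/lip_norm_leP => x y z yz.
rewrite !lipZ -mulrBr !normrM -mulrA -mulrDr ler_wpM2l//.
exact: lip_norm_ge.
Qed.

Lemma lip_normZ c f : lip_norm (c *: f) = `|c| * lip_norm f.
Proof.
apply/eqP; rewrite eq_le lip_normZ_le/=.
have [->|c0] := eqVneq c 0.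
  by rewrite normr0 mul0r (le_trans _ (lip_norm_eval _ zeros)).
rewrite -ler_pdivlMl ?normr_gt0// -normfV.
by rewrite -{1}[f](scalerK c0) lip_normZ_le.
Qed.

Lemma lip_norm0_eq0 f : lip_norm f = 0 -> f = 0.
Proof.
move=> f0; apply: lip_ext => x; apply/eqP.
by rewrite -normr_le0 -f0 lip_norm_eval.
Qed.

HB.instance Definition _ :=
  Lmodule_isNormed.Build R Lip lip_normD lip_normZ lip_norm0_eq0.

Lemma lip_complete (F : set_system Lip) : ProperFilter F -> cauchy F -> cvg F.
Proof.
move=> FF /cauchy_ballP Fc.
have Fn (e : R) : 0 < e -> exists2 A : set Lip, F A &
    forall f g, A f -> A g -> lip_norm (f - g) <= e.
  move=> e0; have [[A B] /= [FA FB] AB] := Fc _ e0.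
  exists (A `&` B); first exact: filterI.
  move=> f g [Af _] [_ Bg]; have := AB (f, g) (conj Af Bg).
  by rewrite -ball_normE/= => /ltW.
pose Fx (x : Sigma) : set_system R := (fun f : Lip => f x) @ F.
have Fx_cvg x : cvg (Fx x).
  apply: cauchy_cvg; apply/cauchy_ballP => e e0.
  have [A FA hA] := Fn (e / 2) ltac:(by rewrite divr_gt0).
  exists ((fun f : Lip => f x) @` A, (fun f : Lip => f x) @` A) => /=.
    by split; apply: (@filterS _ F _ A) => // f Af; exists f.
  move=> [_ _] /= [[f Af <-] [g Ag <-]]; rewrite -ball_normE/=.
  apply: le_lt_trans (lip_norm_eval (f - g) x) _.
  rewrite (le_lt_trans (hA _ _ Af Ag))// ltr_pdivrMr// ltr_pMr// ltr1n//.
pose g (x : Sigma) : R := lim (Fx x).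
have gP (A : set Lip) (e : R) : F A ->
    (forall f h, A f -> A h -> lip_norm (f - h) <= e) -> forall f, A f ->
    forall x y z, y != z ->
    `|f x - g x| + `|(f y - g y) - (f z - g z)| / dist y z <= e.
  move=> FA hA f Af x y z yz.
  have K (h : Lip) : A h ->
      `|f x - h x| + `|(f y - h y) - (f z - h z)| / dist y z <= e.
    by move=> Ah; have /lip_norm_leP/(_ x y z yz) := hA _ _ Af Ah.
  apply: (@closed_cvg _ _ F _ (fun h : Lip =>
      `|f x - h x| + `|(f y - h y) - (f z - h z)| / dist y z)
     [set r | r <= e]) => //.
  - exact: (@filterS _ F _ A).
  - have cE (w : Sigma) : (fun h : Lip => f w - h w) @ F --> f w - g w.
      by apply: cvgB; [exact: cvg_cst|exact: Fx_cvg].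
    apply: cvgD; first exact: cvg_norm.
    by apply: cvgMl; apply: cvg_norm; exact: cvgB.
have glip : g \in lip_pred.
  have [A FA hA] := Fn 1 ltr01; have [f Af] := filter_ex FA.
  have [C C0 hC] := lipP f.
  apply/lip_predP; exists (C + 1) => x y.
  have [->|xy] := eqVneq x y; first by rewrite subrr normr0 distxx mulr0.
  rewrite (_ : g x - g y = (f x - f y) - ((f x - g x) - (f y - g y)));
    last by ring.
  rewrite (le_trans (ler_normB _ _))// mulrDl mul1r lerD//.
  have := gP A 1 FA hA f Af x x y xy.
  rewrite -{2}[dist x y]mul1r -ler_pdivrMr ?dist_gt0//.
  by apply: le_trans; rewrite lerDr.
apply/cvg_ex; exists (MkLip glip); apply/cvgrPdist_le => e e0.
have [A FA hA] := Fn e e0; apply: (@filterS _ F _ A) => // f Af.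
rewrite distrC; apply/lip_norm_leP => x y z yz.
by rewrite !lipB/=; exact: (gP A e FA hA).
Qed.

HB.instance Definition _ := Uniform_isComplete.Build Lip lip_complete.

End dist.

Arguments Lip {R} a.

Definition Lock {R : realType} (a : decr_seq R) : set (Lip a) :=
  [set f : Lip a | exists nu : probability (borel Sigma) R,
    [/\ unique_maximizing sigma f nu,
        supported_on_periodic_orbit sigma nu
      & \forall g \near f, unique_maximizing sigma (lip_val g) nu]].

Arguments Lock {R} a.

(* Main.v *)
From HB Require Import structures.
Require Import Defs.
From mathcomp Require Import all_boot all_order all_algebra.
From mathcomp Require Import ring lra zify.
From mathcomp Require Import all_classical all_reals all_analysis.
From mathcomp Require Import measurable_realfun.

Set Implicit Arguments.
Unset Strict Implicit.
Unset Printing Implicit Defensive.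

Import Order.TTheory GRing.Theory Num.Theory.
Import numFieldNormedType.Exports.

Local Open Scope classical_set_scope.
Local Open Scope ring_scope.

(** Why the theorem holds.

    A function [F] that is Lipschitz for the metric of [a] is determined, up to
    an error of order [a n.+1], by its values on the cylinders of length [n].
    At that resolution ergodic optimization is a finite problem: find the cycle
    of largest mean weight in the graph whose edges are the words of length [n]
    and whose vertices are the words of length [n.-1]. If the best simple cycle
    beats all the others by a large multiple of [a n.+1], then it wins against
    every invariant measure, for [F] and for all functions close to [F]: this is
    locking. So it suffices to find one level [n] with such a gap.

    From the gap to locking ([subaction], [maximizing_of_subaction],
    [lock_of_isolated]). Give each edge the value of [F] on the orbit of the
    best cycle if the edge lies on it, and an upper bound for [F] plus a
    constant otherwise. The gap says that the cycle still has the largest mean,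
    so longest walks define a potential, by which [F] is cohomologous to a
    function that loses a fixed amount off the cycle. The one remaining error,
    on the cylinders of the cycle, is at most the distance to the orbit. That
    distance at least halves at each step back from the moment when the cycle
    is left, so a second coboundary charges it to that moment.

    Creating the gap at random ([card_not_isolated]). Add independent weights,
    uniform in a grid of [K] points, to the edges. Were there two nearly best
    cycles, some edge would lie on one and not on the other. When all the
    weights but that of one edge are fixed, raising that weight by one grid step
    favours the cycles through the edge over the others by at least the gap, so
    at most one grid point makes the edge ambiguous. Summing over the [2 ^ n]
    edges, the gap fails with probability at most [2 ^ n / K]. This is the
    isolation lemma of Mulmuley, Vazirani and Vazirani; a union over edges
    replaces one over cycles, whose number is doubly exponential.

    Where [1 / 4] comes from. A mean over a cycle of length at most [2 ^ n.-1]
    dilutes one weight by that factor, so the grid step must be a little larger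
    than [2 ^ n * a n.+1], and [K] a little larger than [2 ^ n]. The weights
    therefore have size about [4 ^ n * a n.+1], and their sum over all levels
    converges in the Lipschitz norm if [4 ^ n * a n.+1 / a n] decays
    geometrically.

    Prevalence ([law_null], [Lock_prevalent]). The random sum over all levels
    has a compactly supported law. For every translate, given the weights of the
    levels before [n], the level [n] fails to lock with a probability that
    tends to zero, whatever the later levels are, since they contribute only
    [O(a n.+1)]. So almost surely some level locks. The locked functions form
    an open set, and its complement is the required shy Borel set. *)

(** * Words, orbits and simple cycles *)

Definition agree n (x y : Sigma) := forall i, (i < n)%N -> x i = y i.

Definition pre n (x : Sigma) : {ffun 'I_n -> bool} := [ffun i : 'I_n => x i].

Lemma preP n x y : pre n x = pre n y <-> agree n x y.
Proof.
split=> [/ffunP xy i ni|xy]; first by have := xy (Ordinal ni); rewrite !ffunE.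
by apply/ffunP => i; rewrite !ffunE xy.
Qed.

Lemma agree_sym n x y : agree n x y -> agree n y x.
Proof. by move=> xy i /xy. Qed.

Lemma agree_trans n y x z : agree n x y -> agree n y z -> agree n x z.
Proof. by move=> xy yz i ni; rewrite xy// yz. Qed.

Lemma agree_leq k n x y : (k <= n)%N -> agree n x y -> agree k x y.
Proof. by move=> kn xy i ik; apply: xy; apply: leq_trans ik kn. Qed.

Lemma iter_sigmaE k x i : iter k sigma x i = x (k + i)%N.
Proof.
by elim: k x i => // k IH x i; rewrite iterS /sigma IH addnS addSn.
Qed.

Lemma iter_sigmaD k l x : iter k sigma (iter l sigma x) = iter (k + l) sigma x.
Proof. by rewrite iterD. Qed.

Lemma agree_iter k n x y :
  agree (k + n) x y -> agree n (iter k sigma x) (iter k sigma y).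
Proof. by move=> xy i ni; rewrite !iter_sigmaE xy// ltn_add2l. Qed.

Definition cyc p (y : Sigma) : Sigma := fun k => y (k %% p)%N.

Lemma iter_cyc p y : iter p sigma (cyc p y) = cyc p y.
Proof. by apply/funext => k; rewrite iter_sigmaE /cyc modnDl. Qed.

Lemma cyc_agree p m y : (0 < p)%N -> agree m y (iter p sigma y) ->
  agree (p + m) (cyc p y) y.
Proof.
move=> p0 yp k; elim/ltn_ind: k => k IH kpm.
have [kp|pk] := ltnP k p; first by rewrite /cyc modn_small.
have kpk : (k - p < m)%N by rewrite ltn_subLR.
rewrite -(subnKC pk) /cyc modnDl -/(cyc p y _) IH.
- by rewrite yp// iter_sigmaE.
- by lia.
- by lia.
Qed.

(** The walk [y] without its steps [i], ..., [i + p - 1]; when these close a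
    loop, the result visits only edges of [y]. *)
Definition cut i p (y : Sigma) : Sigma :=
  fun k => if (k < i)%N then y k else y (k + p)%N.

Lemma iter_cut i p y : iter i sigma (cut i p y) = iter (i + p) sigma y.
Proof.
apply/funext => k; rewrite !iter_sigmaE /cut ltnNge leq_addr/=.
by congr (y _); lia.
Qed.

Lemma cut_agree i p m y :
  agree m (iter i sigma y) (iter (i + p) sigma y) ->
  agree (i + m) (cut i p y) y.
Proof.
move=> yp k kim; rewrite /cut; case: ltnP => // ik.
have /yp : (k - i < m)%N by lia.
by rewrite !iter_sigmaE subnKC// => ->; congr (y _); lia.
Qed.

(** A closed walk of length [p] in the graph whose vertices are the words of
    length [m] and whose edges are the words of length [m.+1]; it is simple
    because no vertex is visited twice. *)
Definition simple m p (y : Sigma) := [/\ (0 < p)%N, iter p sigma y = y &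
  forall i j, (i < p)%N -> (j < p)%N ->
    agree m (iter i sigma y) (iter j sigma y) -> i = j].

Lemma simple_zeros m : simple m 1 zeros.
Proof. by split=> // i j; rewrite !ltnS !leqn0 => /eqP -> /eqP ->. Qed.

Lemma card_words n : #|{ffun 'I_n -> bool}| = (2 ^ n)%N.
Proof. by rewrite card_ffun card_bool card_ord. Qed.

Lemma simple_le m p y : simple m p y -> (p <= 2 ^ m)%N.
Proof.
move=> [_ _ inj]; rewrite -card_words -[leqLHS]card_ord.
pose f (i : 'I_p) := pre m (iter i sigma y).
suff : injective f by exact: leq_card.
by move=> i j /preP /inj ij; apply/val_inj/ij.
Qed.

Lemma iter_period p y k : iter p sigma y = y -> iter (k * p) sigma y = y.
Proof. by move=> py; elim: k => // k IH; rewrite mulSn iterD IH. Qed.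

Lemma iter_modn p y k : iter p sigma y = y ->
  iter k sigma y = iter (k %% p) sigma y.
Proof.
by move=> py; rewrite {1}(divn_eq k p) addnC iterD iter_period.
Qed.

Definition orb (z : Sigma) : set Sigma := range (fun i => iter i sigma z).

Lemma orb_sigma z c : orb z c -> orb z (sigma c).
Proof. by move=> [i _ <-]; exists i.+1. Qed.

Lemma orb_lt p z c : (0 < p)%N -> iter p sigma z = z -> orb z c ->
  exists2 i, (i < p)%N & c = iter i sigma z.
Proof.
move=> p0 pz [i _ <-]; exists (i %% p)%N; first by rewrite ltn_mod.
exact: iter_modn.
Qed.

Lemma simple_orb m p z c c' : simple m p z -> orb z c -> orb z c' ->
  agree m c c' -> c = c'.
Proof.
move=> [p0 pz inj] /(orb_lt p0 pz)[i ip ->] /(orb_lt p0 pz)[j jp ->].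
by move=> /inj ->.
Qed.

Lemma first_repeat m x : exists i j, [/\ (i < j)%N, (j <= 2 ^ m)%N,
    agree m (iter i sigma x) (iter j sigma x) &
    forall k l, (k < l)%N -> (l < j)%N ->
      ~ agree m (iter k sigma x) (iter l sigma x)].
Proof.
pose P j := [exists i : 'I_j, pre m (iter i sigma x) == pre m (iter j sigma x)].
have PP j : P j <->
    exists2 i, (i < j)%N & agree m (iter i sigma x) (iter j sigma x).
  split=> [/existsP[i /eqP/preP xij]|[i ij /preP xij]]; first by exists i.
  by apply/existsP; exists (Ordinal ij); rewrite xij.
have [j0 j0m Pj0] : exists2 j, (j <= 2 ^ m)%N & P j.
  pose f (i : 'I_(2 ^ m).+1) := pre m (iter i sigma x).
  have : ~ injective f.
    by move=> /leq_card; rewrite card_ord card_words ltnn.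
  move=> /injectiveP/injectivePn[i [j ij fij]].
  wlog ltij : i j ij fij / (i < j)%N.
    move=> h; have [//|/h|/val_inj ijE] := ltngtP i j; first exact: h.
      by apply=> //; rewrite eq_sym.
    by rewrite ijE eqxx in ij.
  exists j; first by rewrite -ltnS.
  by apply/PP; exists i => //; apply/preP.
have exP : exists j, P j by exists j0.
case: (ex_minnP exP) => j Pj jmin.
have [i ij xij] := (PP j).1 Pj.
exists i, j; split=> //; first exact: leq_trans (jmin _ Pj0) j0m.
move=> k l kl lj xkl; have : P l by apply/PP; exists k.
by move=> /jmin; rewrite leqNgt lj.
Qed.

Section birkhoff.
Context {R : realType}.
Implicit Types (w F : Sigma -> R).

Definition bsum w N (x : Sigma) : R := \sum_(i < N) w (iter i sigma x).

Lemma bsum0 w x : bsum w 0 x = 0. Proof. by rewrite /bsum big_ord0. Qed.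

Lemma bsumS w N x : bsum w N.+1 x = bsum w N x + w (iter N sigma x).
Proof. by rewrite /bsum big_ord_recr. Qed.

Lemma bsumD w M N x : bsum w (M + N) x = bsum w M x + bsum w N (iter M sigma x).
Proof.
elim: N => [|N IH]; first by rewrite addn0 bsum0 addr0.
by rewrite addnS !bsumS IH addrA -iterD addnC.
Qed.

Lemma bsum_agree w m N x y : (forall x y, agree m.+1 x y -> w x = w y) ->
  agree (N + m) x y -> bsum w N x = bsum w N y.
Proof.
move=> hw xy; apply: eq_bigr => i _; apply: hw; apply: agree_iter.
by apply: agree_leq xy; rewrite addnS -addSn leq_add2r.
Qed.

Lemma bsum_sigma w p x : iter p sigma x = x ->
  bsum w p (sigma x) = bsum w p x.
Proof.
move=> px; have := bsumD w 1 p x; rewrite [(1 + p)%N]addnC bsumD px addrC.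
by move/addrI => <-.
Qed.

Lemma bsum_iter w p x k : iter p sigma x = x ->
  bsum w p (iter k sigma x) = bsum w p x.
Proof.
move=> px; elim: k => // k IH; rewrite iterS bsum_sigma//.
by rewrite iter_sigmaD addnC -iter_sigmaD px.
Qed.

Lemma bsum_mul w p x k : iter p sigma x = x ->
  bsum w (k * p) x = k%:R * bsum w p x.
Proof.
move=> px; elim: k => [|k IH]; first by rewrite bsum0 mul0r.
by rewrite mulSn bsumD px IH -addn1 natrD mulrDl mul1r addrC.
Qed.

Definition mean F p x : R := bsum F p x / p%:R.

(** Both [p] and [q] are periods of [y], so both means are the mean over [p * q]
    steps. *)
Lemma mean_orb F p q z y : (0 < p)%N -> (0 < q)%N -> iter p sigma z = z ->
  iter q sigma y = y -> orb z y -> mean F q y = mean F p z.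
Proof.
move=> p0 q0 pz qy [k _ ky].
have py : iter p sigma y = y.
  by rewrite -ky iter_sigmaD addnC -iter_sigmaD pz.
apply/eqP; rewrite eqr_div ?pnatr_eq0 -?lt0n// -(bsum_iter _ k pz) ky.
by rewrite mulrC -bsum_mul// [eqbRHS]mulrC -bsum_mul// mulnC.
Qed.

(** A long walk repeats a vertex within its first [2 ^ m] steps; the stretch
    between the two visits is a simple cycle, whose weight is nonpositive, and
    cutting it out leaves a shorter walk. *)
Lemma bsum_bounded w m (B : R) :
  (forall x y, agree m.+1 x y -> w x = w y) -> (forall x, w x <= B) -> 0 <= B ->
  (forall p y, simple m p y -> bsum w p y <= 0) ->
  forall N x, bsum w N x <= (2 ^ m)%:R * B.
Proof.
move=> hw wB B0 hs; elim/ltn_ind => N IH x.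
have [Nm|mN] := leqP N (2 ^ m).
  apply: (@le_trans _ _ (N%:R * B)); last by rewrite ler_wpM2r// ler_nat.
  rewrite /bsum (le_trans (ler_sum _ (fun i _ => wB _)))//.
  by rewrite sumr_const card_ord mulr_natl.
have [i [j [ij jm xij xkl]]] := first_repeat m x.
pose p := (j - i)%N; have p0 : (0 < p)%N by rewrite subn_gt0.
have jE : j = (i + p)%N by rewrite subnKC// ltnW.
pose u := iter i sigma x.
have up : agree m u (iter p sigma u) by rewrite /u -iterD addnC -jE.
have uc := cyc_agree p0 up.
have sc : simple m p (cyc p u).
  split=> //; first exact: iter_cyc.
  suff H k l : (k < l)%N -> (l < p)%N ->
      ~ agree m (iter k sigma (cyc p u)) (iter l sigma (cyc p u)).
    move=> k l kp lp kl; have [/H|/H|//] := ltngtP k l; first by move=> /(_ lp).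
    by move=> /(_ kp); case; apply: agree_sym.
  move=> kl lp klc; apply: (xkl (i + k)%N (i + l)%N); [lia|lia|].
  rewrite ![(i + _)%N]addnC !iterD -/u.
  have A h : (h < p)%N -> agree m (iter h sigma (cyc p u)) (iter h sigma u).
    by move=> hp; apply: agree_iter; apply: agree_leq uc; rewrite leq_add2r ltnW.
  apply: agree_trans (A l lp); apply: agree_trans klc.
  by apply: agree_sym; apply: A; lia.
have NE : N = (i + (p + (N - j)))%N by lia.
rewrite NE 2!bsumD -iterD [(p + i)%N]addnC -/u.
have -> : bsum w i x = bsum w i (cut i p x).
  symmetry; apply: bsum_agree hw _; apply: cut_agree.
  by rewrite -jE.
have := hs _ _ sc; rewrite (bsum_agree hw uc) => segle.
have := IH (i + (N - j))%N ltac:(lia) (cut i p x).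
rewrite bsumD iter_cut.
lra.
Qed.

(** The maximum weight of a walk ending at [x] is a potential: it is finite
    because cycles have nonpositive weight, and appending one step gives the
    inequality. *)
Lemma potential w m (B : R) :
  (forall x y, agree m.+1 x y -> w x = w y) -> (forall x, w x <= B) ->
  (forall p y, simple m p y -> bsum w p y <= 0) ->
  exists h : Sigma -> R, (forall x y, agree m x y -> h x = h y) /\
    forall x, w x + h x <= h (sigma x).
Proof.
move=> hw wB hs.
pose E x := [set r | exists N y, iter N sigma y = x /\ r = bsum w N y].
have Esup x : has_sup (E x).
  split; first by exists 0, 0%N, x; rewrite bsum0.
  exists ((2 ^ m)%:R * `|B|) => _ [N [y [_ ->]]].
  by apply: bsum_bounded => // t; rewrite (le_trans (wB t))// ler_norm.
exists (fun x => sup (E x)); split=> [x y xy|x].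
  suff H x' y' : agree m x' y' -> E x' `<=` E y'.
    by congr sup; apply/seteqP; split; apply: H => //; apply: agree_sym.
  move=> {}xy _ [N [t [tx ->]]].
  pose t' : Sigma := fun k => if (k < N)%N then t k else y' (k - N)%N.
  exists N, t'; split.
    by apply/funext => k; rewrite iter_sigmaE /t' ltnNge leq_addr/= addKn.
  apply: bsum_agree hw _ => k kNm; rewrite /t'; case: ltnP => // Nk.
  rewrite -xy; last by lia.
  by rewrite -tx iter_sigmaE subnKC.
rewrite -lerBrDl; apply: ge_sup; first by case: (Esup x).
move=> _ [N [y [yx ->]]]; rewrite lerBrDl.
apply: ub_le_sup; first by case: (Esup (sigma x)).
by exists N.+1, y; rewrite iterS yx bsumS yx addrC.
Qed.

End birkhoff.

(** * The metric *)

Section metric.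
Context {R : realType} (a : decr_seq R).
Implicit Types (x y z : Sigma) (h : Sigma -> R).

Lemma seq_of_leq m n : (m <= n)%N -> a n <= a m.
Proof.
move=> /subnKC <-; elim: (n - m)%N => [|k IH]; first by rewrite addn0.
by rewrite addnS (le_trans (ltW (seq_of_decr a _))).
Qed.

Lemma dist_first x y : x <> y ->
  exists i, [/\ agree i x y, x i <> y i & dist a x y = a i.+1].
Proof.
move=> /eqP /Sigma_neqP xy; rewrite /dist; case: pselect => // e.
case: (ex_minnP e) => i /eqP xi imin; exists i; split=> // j ji.
by apply/eqP; apply: contraTT ji => /imin; rewrite -leqNgt.
Qed.

Lemma dist_ge0 x y : 0 <= dist a x y.
Proof.
have [->|xy] := eqVneq x y; first by rewrite distxx.
exact/ltW/dist_gt0.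
Qed.

Lemma dist_agree n x y : agree n x y -> dist a x y <= a n.+1.
Proof.
have [->|/eqP/dist_first[i [_ xyi ->]] xy] := eqVneq x y.
  by rewrite distxx ltW// seq_of_gt0.
by apply: seq_of_leq; rewrite ltnS leqNgt; apply/negP => /xy.
Qed.

Lemma dist_nagree n x y : ~ agree n x y -> a n <= dist a x y.
Proof.
have [->|/eqP/dist_first[i [xy _ ->]] nxy] := eqVneq x y; first by case.
apply: seq_of_leq; rewrite ltnNge; apply/negP => ni; apply: nxy.
exact: agree_leq xy.
Qed.

Lemma dist_sym x y : dist a x y = dist a y x.
Proof.
have [->//|/eqP xy] := eqVneq x y.
have [i [xyi ni ->]] := dist_first xy.
have [j [yxj nj ->]] := dist_first (nesym xy).
congr (a _.+1); have [ij|ji|//] := ltngtP i j.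
  by have := yxj _ ij => /esym.
by have := xyi _ ji => /esym.
Qed.

Lemma dist_tri y x z : dist a x z <= dist a x y + dist a y z.
Proof.
have [->|/eqP/dist_first[i [_ xzi ->]]] := eqVneq x z.
  by rewrite distxx addr_ge0// dist_ge0.
have [xy|xy] := pselect (x i = y i).
  rewrite ler_wpDl ?dist_ge0//; apply: dist_nagree => /(_ i (ltnSn _)) yz.
  by apply: xzi; rewrite xy.
rewrite ler_wpDr ?dist_ge0//; apply: dist_nagree => /(_ i (ltnSn _)).
exact: xy.
Qed.

Lemma dist_dist x y c : `|dist a x c - dist a y c| <= dist a x y.
Proof.
have h1 := dist_tri x y c; have h2 := dist_tri y x c.
rewrite [dist a y x]dist_sym in h1; rewrite ler_distl; apply/andP; split; lra.
Qed.

(** Erasing a common first letter moves the first disagreement one place to the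
    left, which replaces a term of [a] by the preceding one. *)
Lemma dist_sigma n x y : (forall j, (n <= j)%N -> a j.+1 <= a j / 2) ->
  agree n x y -> (0 < n)%N ->
  dist a x y <= dist a (sigma x) (sigma y) / 2.
Proof.
move=> ha xy n0; have [->|/eqP/dist_first[i [xyi nxyi ->]]] := eqVneq x y.
  by rewrite !distxx mul0r.
have ni : (n <= i)%N by rewrite leqNgt; apply/negP => /xy.
apply: (le_trans (ha i ni)); rewrite ler_pM2r ?invr_gt0//.
apply: dist_nagree; case: i ni {xyi} nxyi => [|i] ni nxyi; first by lia.
by move=> /(_ i (ltnSn _)).
Qed.

Definition ext n (e : {ffun 'I_n -> bool}) : Sigma :=
  fun k => oapp e false (insub k).

Lemma ext_agree n x : agree n (ext (pre n x)) x.
Proof.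
move=> i ni; rewrite /ext; case: insubP => [j _ <-|]; first by rewrite /= ffunE.
by rewrite ni.
Qed.

Lemma prefix_bounded n h : (forall x y, agree n x y -> h x = h y) ->
  exists B, forall x, `|h x| <= B.
Proof.
move=> hn; exists (\sum_e `|h (@ext n e)|) => x.
by rewrite -(hn _ _ (@ext_agree n x)) (bigD1 (pre n x))//= lerDl sumr_ge0.
Qed.

Lemma prefix_lip n h : (forall x y, agree n x y -> h x = h y) ->
  h \in lip_pred a.
Proof.
move=> hn; have [B hB] := prefix_bounded hn.
apply/lip_predP; exists ((B + B) / a n) => x y.
have B0 : 0 <= B := le_trans (normr_ge0 _) (hB zeros).
have [/hn ->|/dist_nagree an] := pselect (agree n x y).
  by rewrite subrr normr0 mulr_ge0 ?dist_ge0// divr_ge0 ?addr_ge0// ltW ?seq_of_gt0.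
rewrite (le_trans (ler_normB _ _))// (le_trans (lerD (hB _) (hB _)))//.
rewrite mulrAC ler_pdivlMr ?seq_of_gt0// ler_wpM2l// addr_ge0//.
Qed.

Lemma lip_norm_dist (f : Lip a) x y : `|f x - f y| <= lip_norm f * dist a x y.
Proof.
have [->|xy] := eqVneq x y; first by rewrite subrr normr0 distxx mulr0.
rewrite -ler_pdivrMr ?dist_gt0//; apply: le_trans (lip_norm_ge f x xy).
by rewrite lerDr.
Qed.

End metric.

(** * Revealing a strictly dominant periodic orbit by a coboundary *)

Section subaction.
Context {R : realType} (a : decr_seq R).
Variables (m p : nat) (z : Sigma).
Hypothesis sz : simple m p z.

(** Agreement is asked on the [m.+1] letters of an edge rather than on the [m]
    letters of a vertex, so that it also prescribes the next vertex. *)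
Definition on_cycle (x : Sigma) := exists2 c, orb z c & agree m.+1 x c.

Lemma on_cycle_agree x y : agree m.+1 x y -> on_cycle x -> on_cycle y.
Proof.
move=> /agree_sym xy [c zc xc]; exists c => //; exact: agree_trans xc.
Qed.

(** A simple cycle has only one edge out of each of its vertices, so a walk
    along its edges cannot deviate from it. *)
Lemma stay_on_cycle x : (forall k, on_cycle (iter k sigma x)) -> orb z x.
Proof.
move=> H; have [c zc xc] := H 0%N; suff -> : x = c by [].
suff K k : agree m.+1 (iter k sigma x) (iter k sigma c).
  by apply/funext => k; have := K k 0%N isT; rewrite !iter_sigmaE addn0.
elim: k => [//|k IH]; have [c' zc' xc'] := H k.+1.
have <- // : c' = iter k.+1 sigma c.
apply: (simple_orb sz zc').
  by case: zc => i _ <-; exists (k.+1 + i)%N => //; rewrite iterD.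
apply: (@agree_trans _ (iter k.+1 sigma x)).
  by apply: agree_sym; apply: agree_leq xc'.
exact: (@agree_iter 1).
Qed.

(** A base point for each cylinder, taken on the orbit of [z] when the orbit
    meets the cylinder, so that sampling [F] there is exact along the orbit. *)
Definition rep (x : Sigma) : Sigma :=
  if pselect (on_cycle x) is left h then sval (cid2 h) else ext (pre m.+1 x).

Lemma rep_on_cycle x : on_cycle x -> orb z (rep x).
Proof. by rewrite /rep; case: pselect => // h _; case: cid2. Qed.

Lemma rep_agree x : agree m.+1 x (rep x).
Proof.
rewrite /rep; case: pselect => [h|_]; first by case: cid2.
exact/agree_sym/ext_agree.
Qed.

Lemma rep_orb x c : orb z c -> agree m.+1 x c -> rep x = c.
Proof.
move=> zc xc; apply: (simple_orb sz _ zc).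
  by apply: rep_on_cycle; exists c.
apply: (agree_trans (agree_sym (agree_leq (leqnSn _) (rep_agree x)))).
exact: agree_leq xc.
Qed.

Lemma rep_prefix x y : agree m.+1 x y -> rep x = rep y.
Proof.
move=> xy; have [cx|ncx] := pselect (on_cycle x).
  apply/esym/rep_orb; first exact: rep_on_cycle.
  exact: agree_trans (agree_sym xy) (rep_agree x).
have ncy : ~ on_cycle y.
  by move=> cy; apply: ncx; exact: on_cycle_agree (agree_sym xy) cy.
rewrite /rep; do 2 (case: pselect => // _).
by congr ext; apply/preP.
Qed.

Variables (F : Sigma -> R) (L : R).
Hypothesis L0 : 0 < L.
Hypothesis hF : forall x y, `|F x - F y| <= L * dist a x y.
Hypothesis ha : forall j, (m < j)%N -> a j.+1 <= a j / 2.
Hypothesis gap : forall q y, simple m q y ->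
  (exists k, ~ on_cycle (iter k sigma y)) ->
  mean F q y + 5 * L * a m.+2 <= mean F p z.

Let A : R := L * a m.+2.
Let A0 : 0 < A. Proof. by rewrite mulr_gt0// seq_of_gt0. Qed.

(** The edge weights of a function that dominates [F] up to the distance to the
    orbit, with equality on the orbit. Of the [4 * A] charged off the cycle, one
    [A] pays for sampling [F] at a base point and two for the jump of [u] below,
    so that one remains. Before the mean is subtracted, [w] exceeds [F] by at
    most [5 * A], whence the constant in the gap. *)
Let w x := F (rep x) + (if `[< on_cycle x >] then 0 else 4 * A) - mean F p z.

Let w_prefix x y : agree m.+1 x y -> w x = w y.
Proof.
move=> xy; rewrite /w (rep_prefix xy); congr (_ + _ - _).
suff -> : `[< on_cycle x >] = `[< on_cycle y >] by [].
apply: asbool_equiv_eq; split; apply: on_cycle_agree => //.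
exact: agree_sym.
Qed.

Let F_rep x : `|F x - F (rep x)| <= A.
Proof.
apply: (le_trans (hF _ _)); rewrite ler_pM2l//; apply: dist_agree.
exact: rep_agree.
Qed.

Let w_cycle q y : simple m q y -> bsum w q y <= 0.
Proof.
move=> sy; have [q0 qy _] := sy; have [p0 pz _] := sz.
have q0R : 0 < q%:R :> R by rewrite ltr0n.
have [out|] := pselect (exists k, ~ on_cycle (iter k sigma y)).
  have MF : bsum F q y = mean F q y * q%:R by rewrite mulfVK// gt_eqF.
  have : bsum w q y <= \sum_(i < q)
      (F (iter i sigma y) + (5 * A - mean F p z)).
    apply: ler_sum => i _; rewrite /w.
    have := F_rep (iter i sigma y); rewrite ler_norml => /andP[? ?].
    by case: ifPn => _; lra.
  rewrite big_split/= -/(bsum F q y) sumr_const card_ord -[_ *+ q]mulr_natr => Hw.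
  apply: (le_trans Hw); rewrite MF -mulrDl pmulr_lle0//.
  by have := gap sy out; rewrite /A; lra.
move=> inall.
have allon k : on_cycle (iter k sigma y) by apply: contrapT => nk; apply: inall; exists k.
have zy := stay_on_cycle allon.
have zyk k : orb z (iter k sigma y) by elim: k => // k; exact: orb_sigma.
have -> : bsum w q y = \sum_(i < q) (F (iter i sigma y) - mean F p z).
  apply: eq_bigr => i _; rewrite /w (rep_orb (zyk i))//.
  by rewrite asboolT// addr0.
rewrite sumrB sumr_const card_ord -/(bsum F q y) -mulr_natr.
rewrite -(mean_orb F p0 q0 pz qy zy) /mean mulfVK ?subrr// gt_eqF//.
Qed.

(** The second half of the coboundary absorbs the distance to the orbit: this
    distance at least halves at each step back in time from the point where the
    cycle is left. Just before that point it is at most [A], so the cap [2 * A]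
    continues the pattern off the cycle. *)
Let u x := if `[< on_cycle x >] then L * dist a x (rep x) else 2 * A.

Let u_bounds x : 0 <= u x <= 2 * A.
Proof.
rewrite /u; case: ifPn => _; last by apply/andP; split; have := A0; lra.
rewrite mulr_ge0 ?dist_ge0 ?(ltW L0)//=.
apply: (@le_trans _ _ A); last by have := A0; lra.
by rewrite ler_pM2l// dist_agree//; exact: rep_agree.
Qed.

Let u_lip : u \in lip_pred a.
Proof.
apply/lip_predP; exists (2 * L) => x y.
have [xy|nxy] := pselect (agree m.+1 x y).
  have -> : u y = if `[< on_cycle x >] then L * dist a y (rep x) else 2 * A.
    rewrite /u (rep_prefix xy).
    suff -> : `[< on_cycle x >] = `[< on_cycle y >] by [].
    apply: asbool_equiv_eq; split; apply: on_cycle_agree => //.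
    exact: agree_sym.
  rewrite /u; case: ifPn => _; last first.
    by rewrite subrr normr0 mulr_ge0 ?dist_ge0// mulr_ge0// ltW.
  rewrite -mulrBr normrM gtr0_norm// -mulrA.
  have := dist_dist a x y (rep x); rewrite -(ler_pM2l L0) => /le_trans; apply.
  by rewrite ler_peMl ?ler1n// mulr_ge0 ?dist_ge0// ltW.
have d : a m.+2 <= dist a x y.
  exact: le_trans (ltW (seq_of_decr a _)) (dist_nagree a nxy).
have := u_bounds x; have := u_bounds y => /andP[? ?] /andP[? ?].
apply: (@le_trans _ _ (2 * A)); first by rewrite ler_norml; apply/andP; split; lra.
by rewrite /A mulrA ler_wpM2l// mulr_ge0// ltW.
Qed.

Let F_u x : F x + u x <= w x + mean F p z + u (sigma x)
  - (if `[< on_cycle x >] then 0 else A).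
Proof.
have := F_rep x; rewrite ler_norml => /andP[_ hx].
have := u_bounds (sigma x) => /andP[? ?].
rewrite /w subrK {1}/u; case: asboolP => cx; last by lra.
rewrite addr0 subr0.
suff : 2 * (L * dist a x (rep x)) <= u (sigma x).
  by have := hF x (rep x); rewrite ler_norml => /andP[? ?]; lra.
rewrite /u; case: asboolP => csx; last first.
  rewrite ler_wpM2l// ler_pM2l// dist_agree//; exact: rep_agree.
have [zc xc] := (rep_on_cycle cx, rep_agree x).
have -> : rep (sigma x) = sigma (rep x).
  apply: (simple_orb sz (rep_on_cycle csx) (orb_sigma zc)).
  apply: (agree_trans (agree_sym (agree_leq (leqnSn _) (rep_agree _)))).
  exact: (@agree_iter 1).
rewrite mulrCA ler_pM2l// mulrC -ler_pdivlMr//.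
exact: (@dist_sigma _ _ m.+1).
Qed.

(** The gap makes the cycle of [z] the only obstruction to a coboundary that
    lowers [F] below its mean along the orbit of [z]. Moving all errors of the
    approximation by edge weights onto the points near the orbit, where they
    are summable along orbits, costs only a bounded multiple of the
    approximation error. *)
Theorem subaction : exists k : Lip a, forall x,
  F x + k x <= mean F p z + k (sigma x)
    - (if `[< on_cycle x >] then 0 else L * a m.+2).
Proof.
have [B wB] := prefix_bounded w_prefix.
have wB' x : w x <= B by rewrite (le_trans (ler_norm _)).
have [h [hm hh]] := potential w_prefix wB' w_cycle.
pose h' := MkLip (prefix_lip a hm); pose u' := MkLip u_lip.
exists (u' + h') => x; rewrite !lipD /=.
have := hh x; have := F_u x; rewrite -/A.
move: (if _ then _ else _) (mean F p z) (u x) (u (sigma x)) => D M ux usx.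
lra.
Qed.

End subaction.

(** * Periodic orbits as unique maximizing measures *)

Lemma nbhs_agree n (x : Sigma) : nbhs x [set y | agree n x y].
Proof.
elim: n => [|n IH]; first exact: filterS filterT.
have xn : nbhs x [set y : Sigma | y n = x n].
  have := @proj_continuous _ (fun _ : nat => bool) n x.
  by move=> /(_ [set x n]) /=; apply; exact: discrete_set1.
apply: filterS2 IH xn => y /= xy yn i; rewrite ltnS leq_eqVlt => /orP[/eqP->//|].
exact: xy.
Qed.

Lemma open_prefix n (P : set Sigma) : (forall x y, agree n x y -> P x -> P y) ->
  open P.
Proof.
move=> hP; rewrite openE => x Px.
by apply: filterS (nbhs_agree n x) => y xy; exact: hP xy Px.
Qed.

Lemma borel_open (T : ptopologicalType) (A : set T) :
  open A -> measurable (A : set (borel T)).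
Proof. exact: sub_sigma_algebra. Qed.

Lemma sigma_continuous : continuous (sigma : Sigma -> Sigma).
Proof.
move=> x; apply/cvg_sup => i U [_ [[W oW <-] /= Wx WU]].
have : nbhs x [set y | agree i.+2 x y] by exact: nbhs_agree.
apply: filterS => y xy; apply: WU => /=.
by rewrite /sigma -xy.
Qed.

Lemma measurable_sigma :
  measurable_fun setT (sigma : borel Sigma -> borel Sigma).
Proof.
have H : (@measurable _ (borel Sigma)) = <<s @open Sigma >> by [].
apply: (measurability _ H) => _ [U oU <-]; rewrite setTI.
by apply: borel_open; move: U oU; apply/continuousP/sigma_continuous.
Qed.

Lemma continuous_measurable (R : realType) (T : ptopologicalType) (f : T -> R) :
  continuous f -> measurable_fun setT (f : borel T -> R).
Proof.
move=> cf.
apply: (measurability _ (RGenOpens.measurableE R)).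
move=> _ [_ [x [y ->]] <-]; rewrite setTI; apply: borel_open.
by move/continuousP : cf; apply; exact: interval_open.
Qed.

Lemma lip_continuous (R : realType) (a : decr_seq R)
    (a0 : forall e, 0 < e -> exists n, a n < e) (f : Sigma -> R) :
  f \in lip_pred a -> continuous f.
Proof.
move=> lf x; pose f' := MkLip lf; apply/cvgrPdist_le => e e0.
have L0 : 0 < lip_norm f' + 1.
  by rewrite ltr_wpDl// (le_trans _ (lip_norm_eval f' zeros)).
have [n an] := a0 (e / (lip_norm f' + 1)) (divr_gt0 e0 L0).
apply: filterS (nbhs_agree n x) => y /= xy.
apply: (le_trans (lip_norm_dist f' x y)).
apply: (@le_trans _ _ ((lip_norm f' + 1) * dist a x y)).
  by rewrite ler_wpM2r ?dist_ge0// lerDl.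
rewrite mulrC -ler_pdivlMr//; apply: le_trans (ltW an).
by apply: (le_trans (dist_agree a xy)); apply/ltW/seq_of_decr.
Qed.

Section invariant.
Context {R : realType}.
Implicit Types (mu nu : probability (borel Sigma) R) (f g : Sigma -> R).

Definition bounded_measurable f := measurable_fun setT (f : borel Sigma -> R) /\
  exists B, forall x, `|f x| <= B.

Lemma bm_integrable mu f : bounded_measurable f ->
  mu.-integrable setT (EFin \o f).
Proof.
move=> [mf [B fB]]; apply: measurable_bounded_integrable => //.
  by apply: (@le_lt_trans _ _ 1%E); [exact: probability_le1|exact: ltry].
exists B; split; first exact: num_real.
by move=> x Bx y _ /=; rewrite (le_trans (fB y))// ltW.
Qed.

Lemma bmD f g : bounded_measurable f -> bounded_measurable g ->
  bounded_measurable (f \+ g).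
Proof.
move=> [mf [B fB]] [mg [C gC]]; split; first exact: measurable_funD.
by exists (B + C) => x /=; rewrite (le_trans (ler_normD _ _))// lerD.
Qed.

Lemma bm_cst c : bounded_measurable (cst c).
Proof. by split; [exact: measurable_cst|exists `|c| => x]. Qed.

Lemma bmZ c f : bounded_measurable f -> bounded_measurable (fun x => c * f x).
Proof.
move=> [mf [B fB]]; split; first exact: measurable_funM.
by exists (`|c| * B) => x /=; rewrite normrM ler_wpM2l.
Qed.

Lemma bm_indic (A : set Sigma) : measurable (A : set (borel Sigma)) ->
  bounded_measurable (\1_A).
Proof.
move=> mA; split; first exact: measurable_indic.
by exists 1 => x; rewrite indicE; case: (_ \in _); rewrite ?normr1 ?normr0.
Qed.

Lemma bm_sigma f : bounded_measurable f -> bounded_measurable (f \o sigma).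
Proof.
move=> [mf [B fB]]; split; last by exists B => x /=.
exact: (measurableT_comp mf measurable_sigma).
Qed.

Lemma bm_iter f k : bounded_measurable f ->
  bounded_measurable (fun x => f (iter k sigma x)).
Proof.
elim: k f => // k IH f bf; have := IH _ (bm_sigma bf).
by rewrite /comp; under eq_fun do rewrite -iterS.
Qed.

Lemma Rintegral_sigma mu f : invariant_measure sigma mu -> bounded_measurable f ->
  \int[mu]_x f (sigma x) = \int[mu]_x f x.
Proof.
move=> imu bf; rewrite /Rintegral; congr fine.
have [mf _] := bf.
rewrite -[X in X = _](@integral_pushforward _ _ _ _ _ _ measurable_sigma mu
  setT (EFin \o f))//.
- apply: eq_measure_integral => [|ms A mA _]; first exact: measurable_sigma.
  exact: imu.
- exact/measurable_EFinP.
- exact: bm_integrable (bm_sigma bf).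
Qed.

Lemma Rintegral_iter mu f k : invariant_measure sigma mu -> bounded_measurable f ->
  \int[mu]_x f (iter k sigma x) = \int[mu]_x f x.
Proof.
move=> imu bf; elim: k => // k IH; rewrite -{}IH.
under eq_Rintegral do rewrite iterSr.
exact: (Rintegral_sigma imu (bm_iter k bf)).
Qed.

Lemma bsum_bm f N : bounded_measurable f -> bounded_measurable (bsum f N).
Proof.
move=> bf; elim: N => [|N IH].
  suff -> : bsum f 0 = cst 0 by exact: bm_cst.
  by apply/funext => x; rewrite bsum0.
suff -> : bsum f N.+1 = bsum f N \+ (fun x => f (iter N sigma x)).
  exact: bmD IH (bm_iter N bf).
by apply/funext => x; rewrite bsumS.
Qed.

Lemma Rintegral_bsum mu f N : invariant_measure sigma mu -> bounded_measurable f ->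
  \int[mu]_x bsum f N x = N%:R * \int[mu]_x f x.
Proof.
move=> imu bf; elim: N => [|N IH].
  under eq_Rintegral do rewrite bsum0.
  by rewrite Rintegral_cst// !mul0r.
under eq_Rintegral do rewrite bsumS.
rewrite RintegralD//; last 2 first.
- exact: bm_integrable (bsum_bm N bf).
- exact: bm_integrable (bm_iter N bf).
by rewrite IH Rintegral_iter// -addn1 natrD mulrDl mul1r.
Qed.

(** Birkhoff sums over a period are constant on the orbit, so an invariant
    measure carried by the orbit can only integrate to the orbit mean. *)
Lemma Rintegral_orb mu f p z : (0 < p)%N -> iter p sigma z = z ->
  invariant_measure sigma mu -> measurable (orb z : set (borel Sigma)) ->
  mu (~` orb z) = 0%E -> bounded_measurable f -> \int[mu]_x f x = mean f p z.
Proof.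
move=> p0 pz imu mO muO bf.
have p0R : p%:R != 0 :> R by rewrite pnatr_eq0 -lt0n.
apply: (mulfI p0R); rewrite -Rintegral_bsum// [RHS]mulrC mulfVK//.
transitivity (\int[mu]_x (cst (bsum f p z) x)); last first.
  rewrite Rintegral_cst// [X in fine X](_ : _ = 1%E) ?mulr1//.
  exact: probability_setT.
rewrite /Rintegral; congr fine; apply: ae_eq_integral => //.
- by apply/measurable_EFinP; have [] := bsum_bm p bf.
- by apply/measurable_EFinP; exact: measurable_cst.
- have neg : mu.-negligible (~` orb z).
    by apply/negligibleP => //; exact: measurableC.
  apply: negligibleS neg => x /= + zx; apply => _; congr EFin.
  by case: zx => k _ <-; exact: bsum_iter.
Qed.

End invariant.

Section orbit_measure.
Context {R : realType}.

(** The uniform measure on the orbit of a point [z] of period [p.+1]; with this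
    indexing the total mass is 1 without a side condition. *)
Definition orbit_measure p (z : Sigma) : set (borel Sigma) -> \bar R :=
  mscale ((p.+1%:R^-1)%:nng : {nonneg R})
    (msum (fun i => \d_(iter i sigma z : borel Sigma)) p.+1).

HB.instance Definition _ p z := Measure.on (orbit_measure p z).

Lemma orbit_measureE p z (A : set (borel Sigma)) :
  orbit_measure p z A = (mean (\1_(A : set Sigma)) p.+1 z)%:E.
Proof.
rewrite /orbit_measure /= /mscale /msum /= /mean /bsum mulrC EFinM.
by congr (_ * _)%E; rewrite -sumEFin.
Qed.

Lemma orbit_measure_setT p z : orbit_measure p z setT = 1%E.
Proof.
rewrite orbit_measureE /mean /bsum; congr EFin.
under eq_bigr do rewrite indicT.
by rewrite sumr_const card_ord divff// pnatr_eq0.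
Qed.

HB.instance Definition _ p z := Measure_isProbability.Build _ _ _
  (orbit_measure p z) (orbit_measure_setT p z).

Lemma orbit_measure_invariant p z : iter p.+1 sigma z = z ->
  invariant_measure sigma (orbit_measure p z).
Proof.
move=> pz A mA; rewrite -[LHS]/(orbit_measure p z _) -[RHS]/(orbit_measure p z A).
rewrite !orbit_measureE /mean; congr (_ / _)%:E.
rewrite -[RHS](bsum_sigma _ pz); apply: eq_bigr => i _.
by rewrite -iterSr iterS.
Qed.

Lemma orbit_measure_carried p z : orbit_measure p z (~` orb z) = 0%E.
Proof.
rewrite orbit_measureE /mean /bsum big1 ?mul0r// => i _.
by rewrite indicE memNset//= => -[]; exists i.
Qed.

Lemma orbit_measure_supported p z : iter p.+1 sigma z = z ->
  supported_on_periodic_orbit sigma (orbit_measure p z).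
Proof.
by move=> pz; exists z, p.+1; split=> //; exact: orbit_measure_carried.
Qed.

End orbit_measure.

Section maximizing.
Context {R : realType}.
Variables (m p : nat) (z : Sigma).
Hypothesis sz : simple m p.+1 z.
Implicit Types (mu nu : probability (borel Sigma) R) (F h : Sigma -> R).

Let pz : iter p.+1 sigma z = z. Proof. by case: sz. Qed.

Let C : set (borel Sigma) := [set x | on_cycle m z x].

Let mC : measurable C.
Proof.
by apply: borel_open; apply: (@open_prefix m.+1) => x y; exact: on_cycle_agree.
Qed.

(** This form makes the orbit Borel, and shows that an invariant measure that
    does not charge the complement of the cycle is carried by the orbit. *)
Lemma orbE : orb z = \bigcap_k iter k sigma @^-1` C.
Proof.
apply/seteqP; split=> x /=; last by move=> H; apply: (stay_on_cycle sz) => k; exact: H.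
move=> zx k _; exists (iter k sigma x) => //.
by elim: k => // k; exact: orb_sigma.
Qed.

Lemma measurable_iter k :
  measurable_fun setT (iter k sigma : borel Sigma -> borel Sigma).
Proof.
elim: k => [|k IH]; first exact: measurable_id.
exact: (measurableT_comp measurable_sigma IH).
Qed.

Lemma measurable_iterA k (A : set (borel Sigma)) : measurable A ->
  measurable (iter k sigma @^-1` A : set (borel Sigma)).
Proof. by move=> mA; rewrite -[X in measurable X]setTI; exact: measurable_iter. Qed.

Lemma measurable_orb : measurable (orb z : set (borel Sigma)).
Proof. by rewrite orbE; apply: bigcapT_measurable => k; exact: measurable_iterA. Qed.

Lemma invariant_iter mu k (A : set (borel Sigma)) : invariant_measure sigma mu ->
  measurable A -> mu (iter k sigma @^-1` A) = mu A.
Proof.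
move=> imu mA; elim: k => // k IH; rewrite -{}IH.
rewrite -[RHS]imu; last exact: measurable_iterA.
by congr (mu _); apply/funext => x; rewrite /preimage/= -iterS iterSr.
Qed.

Lemma carried_by_orb mu : invariant_measure sigma mu -> mu (~` C) = 0%E ->
  mu (~` orb z) = 0%E.
Proof.
move=> imu mu0; rewrite orbE setC_bigcap.
apply/negligibleP.
  by apply: bigcupT_measurable => k; apply: measurableC; exact: measurable_iterA.
apply: negligible_bigcup => k; apply/negligibleP.
  by apply: measurableC; exact: measurable_iterA.
rewrite preimage_setC; apply: etrans mu0; apply: invariant_iter => //.
exact: measurableC.
Qed.

(** Integrating the coboundary inequality bounds the integral of [F] by its
    orbit mean minus a multiple of the mass that leaves the cycle; an invariant
    measure for which no mass leaves it is carried by the orbit. *)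
Theorem maximizing_of_subaction F h (d : R) : 0 < d ->
  bounded_measurable F -> bounded_measurable h ->
  (forall x, F x + h x <= mean F p.+1 z + h (sigma x)
    - (if `[< on_cycle m z x >] then 0 else d)) ->
  unique_maximizing sigma F (orbit_measure p z).
Proof.
move=> d0 bF bh hF.
have mO := measurable_orb.
have iO : invariant_measure sigma
    (orbit_measure p z : probability (borel Sigma) R) :=
  orbit_measure_invariant pz.
have EI mu : (\int[mu]_x (F x)%:E = (\int[mu]_x F x)%:E)%E.
  by rewrite /Rintegral fineK//; apply: integrable_fin_num => //; exact: bm_integrable.
have IO : \int[orbit_measure p z]_x F x = mean F p.+1 z.
  by apply: Rintegral_orb => //; exact: orbit_measure_carried.
have key mu : invariant_measure sigma mu ->
    \int[mu]_x F x <= mean F p.+1 z - d * fine (mu (~` C)).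
  move=> imu; have mC' : measurable (~` C) by exact: measurableC.
  have bi := @bm_indic R _ mC'.
  have le : \int[mu]_x (F x + h x) <= \int[mu]_x ((mean F p.+1 z + h (sigma x))
      + - d * \1_(~` C) x).
    apply: le_Rintegral => //.
    - exact: bm_integrable (bmD bF bh).
    - exact: bm_integrable (bmD (bmD (bm_cst _) (bm_sigma bh)) (bmZ (- d) bi)).
    - move=> x _; rewrite (le_trans (hF x))// lerD2l mulNr lerN2 indicE.
      case: asboolP => cx; first by rewrite memNset ?mulr0//= => /(_ cx).
      by rewrite mem_set ?mulr1.
  have i1 := bm_integrable mu (bmZ (- d) bi).
  have i2 := bm_integrable mu (bmD (bm_cst (mean F p.+1 z)) (bm_sigma bh)).
  have i3 := bm_integrable mu (bm_sigma bh).
  have i4 := bm_integrable mu (bm_cst (mean F p.+1 z)).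
  have i5 := bm_integrable mu bh.
  have i6 := bm_integrable mu bF.
  have i7 := bm_integrable mu bi.
  move: le; rewrite !RintegralD//.
  rewrite Rintegral_sigma// (RintegralZl _ measurableT i7)//.
  rewrite Rintegral_cst// [X in fine X](_ : _ = 1%E); last exact: probability_setT.
  rewrite [X in _ + _ * X](_ : _ = fine (mu (~` C))); last first.
    by rewrite /Rintegral integral_indic// setIT.
  by rewrite mulr1; lra.
split; first split => // nu inu.
  rewrite !EI lee_fin IO (le_trans (key nu inu))// gerBl.
  by apply: mulr_ge0; [exact: ltW|exact/fine_ge0/measure_ge0].
move=> nu [inu nuM] A mA; have := nuM _ iO; rewrite !EI lee_fin IO => nuF.
have nuC : nu (~` C) = 0%E.
  have fnu : nu (~` C) \is a fin_num.
    by apply: fin_num_measure; exact: measurableC.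
  have := le_trans nuF (key nu inu); rewrite lerBrDl gerDr pmulr_rle0// => nuC.
  rewrite -(fineK fnu); congr EFin; apply/le_anti; rewrite nuC/=.
  exact/fine_ge0/measure_ge0.
have I mu : invariant_measure sigma mu -> mu (~` orb z) = 0%E ->
    mu A = (mean (\1_(A : set Sigma)) p.+1 z)%:E.
  move=> imu muO; rewrite -(Rintegral_orb _ pz imu mO muO (bm_indic mA))//.
  by rewrite /Rintegral integral_indic// setIT fineK// fin_num_measure.
rewrite (I nu)//; last exact: carried_by_orb.
by rewrite (I (orbit_measure p z))//; exact: orbit_measure_carried.
Qed.

End maximizing.

(** * Isolating the best cycle by a random perturbation of the edge weights *)

Section best_cycle.
Context {R : realType}.
Variables (m : nat) (F : Sigma -> R).

(** A simple cycle is determined by its length and the word that it repeats. *)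
Let code := ('I_(2 ^ m).+1 * {ffun 'I_(2 ^ m) -> bool})%type.

Let point_of (c : code) : Sigma := cyc c.1 (ext c.2).

Let simple_code p z : simple m p z -> exists c : code,
  val c.1 = p /\ point_of c = z.
Proof.
move=> sz; have pm := simple_le sz; have [p0 pz _] := sz.
have pm' : (p < (2 ^ m).+1)%N by rewrite ltnS.
exists (Ordinal pm', pre (2 ^ m) z); split=> //.
apply/funext => k; rewrite /point_of /cyc/= ext_agree; last first.
  by rewrite (leq_trans _ pm)// ltn_mod.
by have /(congr1 (fun x : Sigma => x 0%N)) := iter_modn k pz;
  rewrite !iter_sigmaE !addn0.
Qed.

Lemma best_cycle : exists p z, simple m p z /\
  forall q y, simple m q y -> mean F q y <= mean F p z.
Proof.
have [c0 [c01 c0z]] := simple_code (simple_zeros m).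
pose P (c : code) := `[< simple m c.1 (point_of c) >].
pose M (c : code) := mean F c.1 (point_of c).
have Pc0 : P c0 by apply/asboolP; rewrite c01 c0z; exact: simple_zeros.
have [c /asboolP Pc cmax] := @arg_maxP _ _ _ c0 P M Pc0.
exists c.1, (point_of c); split=> // q y sy.
have [d [d1 dy]] := simple_code sy.
have := cmax d; rewrite /M/= dy d1; apply.
by apply/asboolP; rewrite dy d1.
Qed.

End best_cycle.

Section isolation.
Context {R : realType}.
Variables (m K : nat) (F0 : Sigma -> R) (delta eps : R).
Let word := {ffun 'I_m.+1 -> bool}.
Let weights := {ffun word -> 'I_K}.
Implicit Types (X : weights) (e : word).

Definition perturbed X (x : Sigma) : R := F0 x + delta * (X (pre m.+1 x))%:R.

(** Cycles that never leave the cycle of [z] are exempt because they run along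
    the orbit of [z], so that they have the same mean. *)
Definition isolated (F : Sigma -> R) := exists p z, simple m p z /\
  forall q y, simple m q y -> (exists k, ~ on_cycle m z (iter k sigma y)) ->
    mean F q y + eps <= mean F p z.

Let ambiguous e X := exists p z q y, [/\ simple m p z,
  forall q y, simple m q y -> mean (perturbed X) q y <= mean (perturbed X) p z,
  forall i, pre m.+1 (iter i sigma z) != e, simple m q y &
  (exists2 k, (k < q)%N & pre m.+1 (iter k sigma y) = e) /\
  mean (perturbed X) p z < mean (perturbed X) q y + eps].

(** If the gap fails, some cycle close to a best one leaves it, hence uses an
    edge that the best one avoids. *)
Let not_isolated X : ~ isolated (perturbed X) -> exists e, ambiguous e X.
Proof.
move=> niso; have [p [z [sz zmax]]] := best_cycle m (perturbed X).
have [q [y [sy [k out] yz]]] : exists q y, [/\ simple m q y,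
    exists k, ~ on_cycle m z (iter k sigma y) &
    mean (perturbed X) p z < mean (perturbed X) q y + eps].
  apply: contrapT => H; apply: niso; exists p, z; split=> // q y sy out.
  by rewrite leNgt; apply/negP => yz; apply: H; exists q, y.
have [q0 qy _] := sy.
exists (pre m.+1 (iter k sigma y)), p, z, q, y; split=> //.
  move=> i; apply/eqP => /preP H; apply: out.
  by exists (iter i sigma z); [exists i|exact: agree_sym].
split=> //; exists (k %% q)%N; first by rewrite ltn_mod.
by rewrite -iter_modn.
Qed.

Hypothesis delta_eps : (2 ^ m)%:R * eps <= delta.
Hypothesis eps0 : 0 <= eps.

Let delta0 : 0 <= delta.
Proof. by apply: le_trans delta_eps; rewrite mulr_ge0. Qed.

(** Raising the weight of [e] by at least [delta] does not change the cycles that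
    avoid [e], and raises the mean of a simple cycle through [e] by at least
    [delta / 2 ^ m >= eps]. *)
Let ambiguous_uniq e X X' : (forall e', e' != e -> X e' = X' e') ->
  ambiguous e X -> ambiguous e X' -> X e = X' e.
Proof.
suff H (Y Y' : weights) : (forall e', e' != e -> Y e' = Y' e') ->
    ambiguous e Y -> ambiguous e Y' -> (Y e < Y' e)%N -> False.
  move=> XX' aX aX'; apply/val_inj.
  have [/(H _ _ XX' aX aX')//|/H H'|//] := ltngtP (X e) (X' e).
  by case: H' => // e' /XX'.
move=> YY' [p [z [q [y [sz zmax zav sy [[k kq ye] yz]]]]]].
move=> [p' [z' [_ [_ [sz' zmax' zav' _ _]]]]] lt.
have := zmax' q y sy; apply/negP; rewrite -ltNge.
have [q0 qy _] := sy.
have q0R : 0 < q%:R :> R by rewrite ltr0n.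
have -> : mean (perturbed Y') p' z' = mean (perturbed Y) p' z'.
  by congr (_ / _); apply: eq_bigr => i _; rewrite /perturbed YY'.
apply: (le_lt_trans (zmax _ _ sz')); apply: (lt_le_trans yz).
apply: (@le_trans _ _ (mean (perturbed Y) q y + delta / q%:R)).
  rewrite lerD2l ler_pdivlMr// (le_trans _ delta_eps)// mulrC.
  by rewrite ler_wpM2r// ler_nat (simple_le sy).
rewrite /mean -mulrDl ler_pM2r ?invr_gt0//.
have step x : perturbed Y x + (if pre m.+1 x == e then delta else 0) <=
    perturbed Y' x.
  rewrite /perturbed -addrA lerD2l; case: eqVneq => [->|ne].
    rewrite -[X in _ + X]mulr1 -mulrDr ler_wpM2l// natr1 ler_nat//.
  by rewrite addr0 YY'.
apply: (@le_trans _ _ (\sum_(i < q) (perturbed Y (iter i sigma y) +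
    (if pre m.+1 (iter i sigma y) == e then delta else 0)))); last first.
  by apply: ler_sum => i _; exact: step.
rewrite big_split/= lerD2l (bigD1 (Ordinal kq))//= ye eqxx lerDl.
by apply: sumr_ge0 => i _; case: ifP.
Qed.

Lemma card_not_isolated :
  (#|[pred X : weights | `[< ~ isolated (perturbed X) >]]| * K
    <= 2 ^ m.+1 * #|{: weights}|)%N.
Proof.
pose amb e := [pred X : weights | `[< ambiguous e X >]].
have fibre e : (#|amb e| * K <= #|{: weights}|)%N.
  pose f (u : weights * 'I_K) : weights :=
    [ffun e' => if e' == e then u.2 else u.1 e'].
  have finj : {in [predX amb e & 'I_K] &, injective f}.
    move=> [X t] [X' t']; rewrite !inE/= !andbT => /asboolP aX /asboolP aX'.
    move=> /ffunP ff.
    have tt' : t = t' by have := ff e; rewrite !ffunE eqxx.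
    have XX' e' : e' != e -> X e' = X' e'.
      by move=> ne; have := ff e'; rewrite !ffunE (negPf ne).
    congr pair => //; apply/ffunP => e'.
    have [->|] := eqVneq e' e; last exact: XX'.
    exact: ambiguous_uniq aX aX'.
  by have := leq_card_in _ _ finj; rewrite cardX card_ord.
apply: (@leq_trans (\sum_e #|amb e| * K)%N).
  rewrite -big_distrl/= leq_mul2r; apply/orP; right.
  under [X in (_ <= X)%N]eq_bigr do rewrite -sum1_card big_mkcond/=.
  rewrite exchange_big -sum1_card big_mkcond/=; apply: leq_sum => X _.
  rewrite inE; case: asboolP => // /not_isolated[e aX].
  by rewrite (bigD1 e)//= inE asboolT.
apply: (@leq_trans (\sum_(e : word) #|{: weights}|)%N).
  exact: leq_sum.
by rewrite sum_nat_const card_words.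
Qed.

End isolation.

(** * Isolation implies locking *)

Section locking.
Context {R : realType} (a : decr_seq R).
Hypothesis a_small : forall e, 0 < e -> exists n, a n < e.

Lemma lip_bm (f : Lip a) : bounded_measurable f.
Proof.
split; last by exists (lip_norm f) => x; exact: lip_norm_eval.
exact: continuous_measurable (lip_continuous a_small (lip_valP f)).
Qed.

Lemma mean_le (F G : Sigma -> R) t q y : (0 < q)%N ->
  (forall x, F x <= G x + t) -> mean F q y <= mean G q y + t.
Proof.
move=> q0 FG; rewrite ler_pdivrMr ?ltr0n// mulrDl mulfVK ?pnatr_eq0 -?lt0n//.
apply: (@le_trans _ _ (\sum_(i < q) (G (iter i sigma y) + t))).
  by apply: ler_sum => i _; exact: FG.
by rewrite big_split/= sumr_const card_ord mulr_natr.
Qed.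

(** All the estimates are stable under a small change of the function, and they
    always lead to the same orbit. *)
Theorem lock_of_isolated m (F : Sigma -> R) (G : Lip a) (t L eps : R) :
  (forall j, (m < j)%N -> a j.+1 <= a j / 2) ->
  (forall x, `|G x - F x| <= t) -> isolated m eps F -> lip_norm G + 1 <= L ->
  5 * L * a m.+2 + 2 * (t + a m.+2) <= eps -> Lock a G.
Proof.
move=> ha GF [p [z [sz zmax]]] GL eps_ge.
case: p sz zmax => [[]//|p] sz zmax; have [_ pz _] := sz.
have L0 : 0 < L.
  apply: lt_le_trans GL; rewrite ltr_wpDl//.
  exact: le_trans (lip_norm_eval G zeros).
pose r := Num.min 1 (a m.+2).
have r0 : 0 < r by rewrite lt_min ltr01 seq_of_gt0.
have main (H : Lip a) : lip_norm (G - H) < r ->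
    unique_maximizing sigma H (orbit_measure p z : probability (borel Sigma) R).
  rewrite lt_min => /andP[GH1 GHa].
  have HL x y : `|H x - H y| <= L * dist a x y.
    apply: (le_trans (lip_norm_dist H x y)).
    rewrite ler_wpM2r ?dist_ge0//; apply: le_trans GL.
    have := lip_normD G (H - G); rewrite subrKC => /le_trans; apply.
    have := normrN (G - H); rewrite opprB => E.
    by rewrite lerD2l -[lip_norm _]/(`|H - G|) E ltW.
  have HF x : `|H x - F x| <= t + a m.+2.
    rewrite -(subrKA (G x)) addrC (le_trans (ler_normD _ _))// lerD//.
    by rewrite distrC -lipB (le_trans (lip_norm_eval _ _))// ltW.
  have gap q y : simple m q y -> (exists k, ~ on_cycle m z (iter k sigma y)) ->
      mean H q y + 5 * L * a m.+2 <= mean H p.+1 z.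
    move=> sy out; have := zmax q y sy out; have [q0 _ _] := sy.
    have h1 : mean H q y <= mean F q y + (t + a m.+2).
      apply: mean_le => // x.
      by have := HF x; rewrite ler_norml => /andP[_]; rewrite lerBlDl.
    have h2 : mean F p.+1 z <= mean H p.+1 z + (t + a m.+2).
      apply: mean_le => // x.
      by have := HF x; rewrite distrC ler_norml => /andP[_]; rewrite lerBlDl.
    lra.
  have [k hk] := subaction sz L0 HL ha gap.
  have d0 : 0 < L * a m.+2 by rewrite mulr_gt0// seq_of_gt0.
  exact: (maximizing_of_subaction sz d0 (lip_bm H) (lip_bm k) hk).
exists (orbit_measure p z : probability (borel Sigma) R); split.
- by apply: main; rewrite subrr -(scale0r G) lip_normZ normr0 mul0r.
- exact: orbit_measure_supported.
- apply/nbhs_ballP; exists r => //= H; rewrite -ball_normE/=; exact: main.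
Qed.

Lemma Lock_PU (f : Lip a) : Lock a f -> PU sigma f.
Proof.
move=> [nu [nuM nuP _]]; split; last by exists nu.
exact: (lip_continuous a_small (lip_valP f)).
Qed.

Lemma open_Lock : open (Lock a).
Proof.
rewrite openE => f [nu [_ nuP fnear]].
have := near_join fnear; apply: filterS => g gnear.
by exists nu; split=> //; exact: nbhs_singleton gnear.
Qed.

End locking.

(** * Random series with independent digits in a Banach space *)

Lemma nbhs_digits (s : prod_topology (fun _ : nat => nat)) n :
  nbhs s [set s' | forall i, (i < n)%N -> s i = s' i].
Proof.
elim: n => [|n IH]; first exact: filterS filterT.
have sn : nbhs s [set s' : prod_topology (fun _ : nat => nat) | s' n = s n].
  have := @proj_continuous _ (fun _ : nat => nat) n s.
  by move=> /(_ [set s n]) /=; apply; exact: discrete_set1.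
apply: filterS2 IH sn => s' /= ss' s'n i; rewrite ltnS leq_eqVlt.
by move=> /orP[/eqP->//|]; exact: ss'.
Qed.

Section random_series.
Context {R : realType} {V : completeNormedModType R}.
Variables (N : nat -> nat) (h : nat -> nat -> V) (C q : R).
Hypothesis N0 : forall j, (0 < N j)%N.
Hypothesis q01 : 0 < q < 1.
Hypothesis C0 : 0 <= C.
Hypothesis hC : forall j d, `|h j d| <= C * q ^+ j.


Implicit Types (s : nat -> nat).

Definition partial s n : V := \sum_(i < n) h i (s i).

Definition random_sum s : V := lim (partial s @ \oo).

Definition tail n : R := C * q ^+ n / (1 - q).

Let q1 : 0 < 1 - q. Proof. by have /andP[_ ?] := q01; rewrite subr_gt0. Qed.
Let q0 : 0 < q. Proof. by have /andP[? _] := q01. Qed.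

Lemma tail_ge0 n : 0 <= tail n.
Proof. by rewrite divr_ge0 ?mulr_ge0 ?exprn_ge0// ltW. Qed.

Lemma tailS n : C * q ^+ n + tail n.+1 = tail n.
Proof.
rewrite /tail exprS; field; exact: lt0r_neq0.
Qed.

Lemma tail_leq m n : (m <= n)%N -> tail n <= tail m.
Proof.
move=> /subnKC <-; elim: (n - m)%N => [|k IH]; first by rewrite addn0.
apply: le_trans IH; rewrite addnS -(tailS (m + k)) lerDr.
by rewrite mulr_ge0// exprn_ge0// ltW.
Qed.

Lemma partial_tail s n k : `|partial s (n + k) - partial s n| <= tail n - tail (n + k).
Proof.
elim: k => [|k IH]; first by rewrite addn0 !subrr normr0.
rewrite addnS /partial big_ord_recr/= -/(partial s (n + k)) addrAC.
rewrite (le_trans (ler_normD _ _))// (le_trans (lerD IH (hC _ _)))//.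
have := tailS (n + k); lra.
Qed.

Lemma partial_cvg s : partial s @ \oo --> random_sum s.
Proof.
have E : partial s = series (fun i => h i (s i)).
  by apply/funext => n; rewrite /partial /series/= big_mkord.
rewrite /random_sum E; apply: normed_cvg.
apply: (@series_le_cvg _ _ (geometric C q)) => [n|n|n|].
- exact: normr_ge0.
- by rewrite /geometric/= mulr_ge0// exprn_ge0// ltW.
- exact: hC.
- by apply: is_cvg_geometric_series; rewrite (gtr0_norm q0) -subr_gt0.
Qed.

Lemma random_sum_tail s n : `|random_sum s - partial s n| <= tail n.
Proof.
apply: (@closed_cvg _ _ (\oo) _ (fun k => `|partial s k - partial s n|)
  [set r | r <= tail n]) => //.
- exists n => //= k /= nk; rewrite -(subnKC nk).
  by apply: le_trans (partial_tail s n (k - n)) _; rewrite gerBl tail_ge0.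
- by apply: cvg_norm; apply: cvgB; [exact: partial_cvg|exact: cvg_cst].
Qed.

Lemma random_sum_agree s s' n : (forall i, (i < n)%N -> s i = s' i) ->
  `|random_sum s - random_sum s'| <= 2 * tail n.
Proof.
move=> ss'; have E : partial s n = partial s' n.
  by apply: eq_bigr => i _; rewrite ss'.
rewrite -(subrKA (partial s n)) (le_trans (ler_normD _ _))//.
rewrite mulr_natl mulr2n lerD ?random_sum_tail// E distrC.
exact: random_sum_tail.
Qed.

Lemma tail_small e : 0 < e -> exists n, 2 * tail n < e.
Proof.
move=> e0.
have : (fun n => geometric (2 * (C / (1 - q))) q n) @ \oo --> (0 : R).
  by apply: cvg_geometric; rewrite (gtr0_norm q0) -subr_gt0.
move=> /cvgrPdist_lt/(_ e e0)[n _ /(_ n (leqnn n))] /=.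
rewrite sub0r normrN => H; exists n; apply: le_lt_trans H.
rewrite (le_trans _ (ler_norm _))// /tail /geometric/=.
by rewrite le_eqVlt; apply/orP; left; apply/eqP; ring.
Qed.

Definition digits := [set s : prod_topology (fun _ : nat => nat) |
  forall i, (s i < N i)%N].

Lemma compact_digits : compact digits.
Proof.
have := @tychonoff _ (fun _ : nat => nat) (fun i => [set d | (d < N i)%N]).
apply => i; apply: finite_compact; exact: finite_II.
Qed.

Lemma random_sum_continuous :
  continuous (random_sum : prod_topology (fun _ : nat => nat) -> V).
Proof.
move=> s; apply/cvgrPdist_lt => e /tail_small[n ne].
apply: filterS (nbhs_digits s n) => s' /= ss'.
exact: le_lt_trans (random_sum_agree ss') ne.
Qed.

Lemma compact_random_sum : compact (random_sum @` digits).
Proof.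
apply: continuous_compact compact_digits; apply: continuous_subspaceT.
exact: random_sum_continuous.
Qed.

(** The digits of a uniform random number, in the mixed-radix expansion with
    bases [N 0], [N 1], ...: a sequence of independent uniform digits. *)
Definition base j := (\prod_(i < j) N i)%N.

Lemma base_gt0 j : (0 < base j)%N.
Proof. exact: prodn_gt0. Qed.

Lemma baseS j : base j.+1 = (base j * N j)%N.
Proof. by rewrite /base big_ord_recr. Qed.

Definition num j (U : R) : nat := Num.truncn (U * (base j)%:R).

Definition digit (U : R) j : nat := (num j.+1 U %% N j)%N.

(** Truncating at the resolution of [base j] drops the last digit that is visible
    at the resolution of [base j.+1]. *)
Lemma num_divn j U : num j U = (num j.+1 U %/ N j)%N.
Proof.
suff H k : (num j U <= k)%N = (num j.+1 U %/ N j <= k)%N.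
  by apply/anti_leq/andP; split; [rewrite H|rewrite -H].
rewrite -[RHS]ltnS ltn_divLR// /num truncn_le_nat.
have [n nE] : exists n, (k.+1 * N j)%N = n.+1.
  by exists (k.+1 * N j).-1; rewrite prednK// muln_gt0 N0.
rewrite nE ltnS truncn_le_nat -nE baseS !natrM mulrA ltr_pM2r// ltr0n//.
Qed.

Lemma digit_lt U j : (digit U j < N j)%N.
Proof. exact: ltn_pmod. Qed.

Lemma num_digits n U U' : num n U = num n U' ->
  forall i, (i < n)%N -> digit U i = digit U' i.
Proof.
elim: n => // n IH UU' i; rewrite ltnS leq_eqVlt => /orP[/eqP ->|].
  by rewrite /digit UU'.
by apply: IH; rewrite (num_divn n U) (num_divn n U') UU'.
Qed.

Definition cell n k := [set U : R | num n U = k].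

Lemma measurable_cell n k : measurable (cell n k).
Proof.
have H l : measurable [set U : R | (num n U <= l)%N].
  suff -> : [set U : R | (num n U <= l)%N] = `]-oo, l.+1%:R / (base n)%:R[%classic.
    exact: measurable_itv.
  apply/seteqP; split=> U /=;
    by rewrite in_itv/= truncn_le_nat ltr_pdivlMr// ltr0n base_gt0.
have -> : cell n k = [set U | (num n U <= k)%N] `\`
    (if k is l.+1 then [set U : R | (num n U <= l)%N] else set0).
  case: k => [|k]; apply/seteqP; split=> U /=; rewrite /cell/=.
  - by move=> ->; split.
  - by rewrite leqn0 => -[/eqP ->].
  - by move=> ->; split=> //; rewrite ltnn.
  - by move=> [Uk /negP]; rewrite -ltnNge => kU; apply/eqP; rewrite eqn_leq Uk.
by apply: measurableD => //; case: k.
Qed.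

Definition random_point (U : R) : V := random_sum (digit U).

(** The random sum is a uniform limit of step functions constant on cells, so
    the preimage of an open set is a union of cells. *)
Lemma measurable_random_point :
  measurable_fun setT (random_point : measurableTypeR R -> borel V).
Proof.
have H : (@measurable _ (borel V)) = <<s @open V >> by [].
apply: (measurability _ H) => _ [B oB <-]; rewrite setTI.
have -> : random_point @^-1` B = \bigcup_n \bigcup_(k in
    [set k | cell n k `<=` random_point @^-1` B])
    (cell n k : set (measurableTypeR R)).
  apply/seteqP; split=> [U /= BU|U [n _ [k /= +]]]; last by move=> /(_ U).
  have : nbhs (random_point U) B by exact: open_nbhs_nbhs.
  move=> /nbhs_ballP[e /= e0 eB]; have [n ne] := tail_small e0.
  exists n => //; exists (num n U) => // U' /= UU'.
  apply: eB; rewrite -ball_normE/=.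
  apply: le_lt_trans ne; apply: random_sum_agree; apply: num_digits.
  by rewrite UU'.
apply: bigcupT_measurable => n; apply: bigcup_measurable => k _.
exact: measurable_cell.
Qed.

Definition uniform01 : probability _ R := uniform_prob (@ltr01 R).

Lemma uniform01E (A : set R) : measurable A ->
  uniform01 A = lebesgue_measure (A `&` `[0, 1]%classic).
Proof.
move=> mA; rewrite /uniform01/= /uniform_prob integral_uniform_pdf.
rewrite (eq_integral (fun=> 1%E)) ?integral_cst ?mul1e//.
  by apply: measurableI.
move=> x; rewrite inE /= in_itv/= => -[_ x01].
by rewrite /uniform_pdf x01 subr0 invr1.
Qed.

(** The cells beyond the unit interval are null, so that only an upper bound
    holds for all of them. *)
Lemma uniform01_cell n k : (uniform01 (cell n k) <= ((base n)%:R^-1)%:E)%E.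
Proof.
have b0 : 0 < (base n)%:R :> R by rewrite ltr0n base_gt0.
rewrite uniform01E; last exact: measurable_cell.
pose I := `[k%:R / (base n)%:R, k.+1%:R / (base n)%:R[%classic : set R.
apply: (@le_trans _ _ (lebesgue_measure I)).
  apply: le_measure; rewrite ?inE.
  - by apply: measurableI => //; exact: measurable_cell.
  - exact: measurable_itv.
  move=> U [cU]; rewrite /I /= !in_itv/= -cU => /andP[U0 _].
  by rewrite ler_pdivrMr// ltr_pdivlMr// truncn_itv// mulr_ge0// ltW.
rewrite lebesgue_measure_itv/= lte_fin ltr_pM2r ?invr_gt0// ltr_nat ltnSn.
by rewrite -EFinD -mulrBl -natrB// subSnn mul1r.
Qed.

Definition law : probability (borel V) R :=
  distribution uniform01 (mfun_Sub (mem_set measurable_random_point)).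

Lemma law_compact : compactly_supported law.
Proof.
exists (random_sum @` digits); split; first exact: compact_random_sum.
rewrite /law/= /distribution /pushforward/=.
suff -> : random_point @^-1` (~` (random_sum @` digits)) = set0 by rewrite measure0.
rewrite -subset0 => U /=; apply; exists (digit U) => // i; exact: digit_lt.
Qed.

(** This stands in for a conditional probability given the digits before [j]:
    counting all the digits that some continuation makes bad dispenses with the
    distribution of the later ones. *)
Definition bad_digits (A : set V) j s := [pred d : 'I_(N j) | `[< exists s',
  [/\ digits s', forall i, (i < j)%N -> s' i = s i, s' j = d &
      A (random_sum s')] >]].

Let bad_cell (A : set V) j k := `[< exists2 U, cell j k U & A (random_point U) >].

Let card_bad_cell A j D :
  (forall s, digits s -> (#|bad_digits A j s| * D <= N j)%N) ->
  ((\sum_(0 <= k < base j.+1) bad_cell A j.+1 k) * D <= base j.+1)%N.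
Proof.
move=> HD; rewrite baseS big_nat_mul big_distrl/=.
apply: (@leq_trans (\sum_(0 <= i < base j) N j)); last first.
  by rewrite sum_nat_const_nat subn0.
apply: leq_sum => i _.
rewrite -{1}[(i * N j)%N]add0n big_addn mulSn addnK big_mkord.
have num_j U (d : 'I_(N j)) : cell j.+1 (d + i * N j) U ->
    num j U = i /\ digit U j = d.
  move=> cU; rewrite num_divn /digit cU [(d + _)%N]addnC.
  by rewrite divnMDl// modnMDl divn_small// modn_small// addn0.
have [[d0 /asboolP[U0 c0 A0]]|none] :=
    pselect (exists d : 'I_(N j), bad_cell A j.+1 (d + i * N j)); last first.
  rewrite big1// => d _; apply/eqP; rewrite eqb0; apply/negP => bd.
  by apply: none; exists d.
have [n0 _] := num_j _ _ c0.
apply: leq_trans (HD (digit U0) (digit_lt U0)); rewrite leq_mul2r; apply/orP; right.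
rewrite -sum1_card [leqRHS]big_mkcond/=; apply: leq_sum => d _.
rewrite /bad_cell; case: asboolP => // -[U c AU].
have [nU dU] := num_j _ _ c.
rewrite inE asboolT//; exists (digit U); split=> //; first exact: digit_lt.
by apply: num_digits; rewrite nU.
Qed.

(** If, at some level, at most one digit in [D.+1] is bad whatever the preceding
    digits are, then the bad event is covered by cells of total length at most
    [1 / D.+1]. *)
Theorem law_null (A : set V) : measurable (A : set (borel V)) ->
  (forall D, exists j, forall s, digits s ->
    (#|bad_digits A j s| * D.+1 <= N j)%N) -> law A = 0%E.
Proof.
move=> mA HA.
suff H D : (law A <= (D.+1%:R^-1)%:E)%E.
  apply/le_anti; rewrite measure_ge0 andbT; apply/lee_addgt0Pr => e e0.
  have [D De] := ltr_add_invr e0.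
  apply: (le_trans (H D)); rewrite add0e lee_fin ltW//.
  by rewrite -[X in X < _]add0r.
have [j Hj] := HA D; have := card_bad_cell Hj.
set b := bad_cell A j.+1 => cardb.
pose F k : set R := if b k then cell j.+1 k else set0.
have mF k : measurable (F k) by rewrite /F; case: ifP => // _; exact: measurable_cell.
pose W0 : set R := \big[setU/set0]_(k < base j.+1) F k.
have mW0 : measurable W0 by apply: bigsetU_measurable => k _; exact: mF.
pose W := W0 `|` [set 1].
have mW : measurable W by exact: measurableU.
have mG : measurable (random_point @^-1` A).
  by rewrite -[X in measurable X]setTI; exact: measurable_random_point.
have PW : (uniform01 (random_point @^-1` A) <= uniform01 W)%E.
  rewrite !uniform01E//; apply: le_measure; rewrite ?inE; [exact: measurableI|exact: measurableI|].
  move=> U /= [AU]; rewrite in_itv/= => /andP[U0 U1]; split; last by rewrite U0 U1.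
  move: U1; rewrite le_eqVlt => /orP[/eqP ->|U1]; first by right.
  left; have bn : (num j.+1 U < base j.+1)%N.
    by rewrite /num truncn_lt_nat ?mulr_ge0// gtr_pMl// ltr0n base_gt0.
  rewrite /W0 -bigcup_mkord; exists (num j.+1 U) => //.
  by rewrite /F ifT//; apply/asboolP; exists U.
have m1 : measurable ([set 1] : set (measurableTypeR R)) by [].
have := measureU2 uniform01 mW0 m1 => /(le_trans PW)/le_trans; apply.
have u1 : uniform01 [set 1 : R] = 0%E.
  rewrite uniform01E//; apply/eqP; rewrite -measure_le0.
  rewrite -(lebesgue_measure_set1 (1 : R)); apply: le_measure; rewrite ?inE//.
  by apply: measurableI.
rewrite [X in (_ + X <= _)%E](_ : _ = 0%E); last exact: u1.
rewrite adde0; have B := @Boole_inequality _ _ _ uniform01 F (base j.+1)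
  (fun k _ => mF k).
apply: (le_trans B).
apply: (@le_trans _ _ (\sum_(k < base j.+1) ((b k)%:R / (base j.+1)%:R)%:E)%E).
  apply: lee_sum => k _; rewrite /F; case: ifP => _.
    by rewrite mul1r uniform01_cell.
  by rewrite measure0 mul0r.
rewrite sumEFin lee_fin -mulr_suml -natr_sum.
rewrite ler_pdivrMr ?ltr0n ?base_gt0// mulrC ler_pdivlMr ?ltr0n//.
by rewrite -natrM ler_nat -(big_mkord xpredT (fun k => nat_of_bool (b k))).
Qed.

End random_series.

(** * The random perturbation *)

Lemma measurable_translate (R : realType) (V : completeNormedModType R)
  (A : set V) (v : V) : open A ->
  measurable ([set x + v | x in ~` A] : set (borel V)).
Proof.
move=> oA; have -> : [set x + v | x in ~` A] = ~` ((fun x => x - v) @^-1` A).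
  apply/seteqP; split=> [_ [x nx <-]|x /= nx]; first by rewrite /= addrK.
  by exists (x - v) => //; rewrite subrK.
apply: measurableC; apply: borel_open; apply: open_comp oA => x _.
by apply: cvgB; [exact: cvg_id|exact: cvg_cst].
Qed.

Section perturbation.
Context {R : realType} (a : decr_seq R).
Variables (m0 : nat) (c q : R).

Definition vertex_len j := (m0 + j)%N.

(** The union over [2 ^ (vertex_len j).+1] edges must be beaten by a factor that
    tends to infinity, here [j.+1]. *)
Definition nweights j := (2 ^ (vertex_len j).+1 * j.+1)%N.

(** The power of two covers the dilution of one weight in a cycle mean; [j.+1]
    eventually exceeds every constant that depends on the translate. *)
Definition step j : R := j.+1%:R * (2 ^ (vertex_len j).+1)%:R * a (vertex_len j).+2.

Definition weights j :=
  {ffun {ffun 'I_(vertex_len j).+1 -> bool} -> 'I_(nweights j)}.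

Lemma nweights_gt0 j : (0 < nweights j)%N.
Proof. by rewrite muln_gt0 expn_gt0. Qed.

Definition bump_fun j (X : weights j) (x : Sigma) : R :=
  step j * (X (pre (vertex_len j).+1 x))%:R.

Lemma bump_prefix j (X : weights j) x y :
  agree (vertex_len j).+1 x y -> bump_fun X x = bump_fun X y.
Proof. by rewrite /bump_fun => /preP ->. Qed.

Definition bump j (X : weights j) : Lip a :=
  MkLip (prefix_lip a (@bump_prefix j X)).

Definition height j : R := (nweights j)%:R * step j.

Lemma step_ge0 j : 0 <= step j.
Proof. by rewrite mulr_ge0// ltW// seq_of_gt0. Qed.

Lemma bump_bounds j (X : weights j) x : 0 <= bump X x <= height j.
Proof.
rewrite /= /bump_fun mulr_ge0 ?step_ge0//= /height mulrC ler_wpM2r ?step_ge0//.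
by rewrite ler_nat ltnW.
Qed.

Hypothesis q01 : 0 < q < 1.
Hypothesis c0 : 0 <= c.
Hypothesis heightP : forall j, height j <= c * q ^+ j * a (vertex_len j).+1.

Lemma bump_norm j (X : weights j) : `|bump X| <= (1 + a 0%N) * c * q ^+ j.
Proof.
have aj := seq_of_gt0 a (vertex_len j).+1.
have cq0 : 0 <= c * q ^+ j by rewrite mulr_ge0// exprn_ge0// ltW//; case/andP: q01.
apply/lip_norm_leP => x y z yz.
have /andP[? ?] := bump_bounds X x.
have /andP[? ?] := bump_bounds X y.
have /andP[? ?] := bump_bounds X z.
rewrite -mulrA mulrDl mul1r addrC lerD//.
  rewrite ler_pdivrMr ?dist_gt0//.
  have [yzj|/(dist_nagree a) d] := pselect (agree (vertex_len j).+1 y z).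
    by rewrite /= (bump_prefix _ yzj) subrr normr0 mulr_ge0// dist_ge0.
  apply: (@le_trans _ _ (height j)); first by rewrite ler_norml; apply/andP; split; lra.
  by apply: (le_trans (heightP j)); rewrite ler_wpM2l.
rewrite ger0_norm//; apply: (@le_trans _ _ (height j)) => //.
by apply: (le_trans (heightP j)); rewrite mulrC ler_wpM2r// seq_of_le.
Qed.

(** Weight vectors are coded by integers so that all the levels share one
    sequence of digits. *)
Definition nvectors j := #|{: weights j}|.

Definition vector j (d : nat) : weights j :=
  nth [ffun=> Ordinal (nweights_gt0 j)] (enum {: weights j}) d.

Lemma vectorE j (d : 'I_(nvectors j)) : vector j d = enum_val d.
Proof. by rewrite /vector -enum_val_nth. Qed.

Lemma nvectors_gt0 j : (0 < nvectors j)%N.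
Proof. by apply/card_gt0P; exists (vector j 0). Qed.

Definition level_bump j d : Lip a := bump (vector j d).

Let C := (1 + a 0%N) * c.

Let C0 : 0 <= C.
Proof. by rewrite mulr_ge0// addr_ge0// ltW// seq_of_gt0. Qed.

Let humpP j d : `|level_bump j d| <= C * q ^+ j.
Proof. exact: bump_norm. Qed.

Let q1 : 0 < 1 - q. Proof. by have /andP[_ ?] := q01; rewrite subr_gt0. Qed.

Notation psum := (partial level_bump).
Notation rsum := (random_sum level_bump).

(** The later levels are Lipschitz perturbations of bounded norm, but they are
    uniformly small only because the heights decrease with [a]. *)
Lemma later_levels s n x :
  `|rsum s x - psum s n x| <= c / (1 - q) * a (vertex_len n).+1.
Proof.
have psumS k : psum s k.+1 x = psum s k x + level_bump k (s k) x.
  by rewrite /partial big_ord_recr.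
pose b n : R := c * q ^+ n / (1 - q).
have b_ge0 k : 0 <= b k.
  by rewrite divr_ge0 ?mulr_ge0 ?exprn_ge0// ltW//; case/andP: q01.
have bS k : c * q ^+ k + b k.+1 = b k.
  by rewrite /b exprS; field; exact: lt0r_neq0.
have H k : `|psum s (n + k) x - psum s n x| <=
    (b n - b (n + k)%N) * a (vertex_len n).+1.
  elim: k => [|k IH]; first by rewrite addn0 !subrr normr0 mul0r.
  rewrite addnS psumS addrAC (le_trans (ler_normD _ _))//.
  have /andP[h0 h1] := bump_bounds (vector (n + k) (s (n + k)%N)) x.
  rewrite [X in _ + X]ger0_norm//.
  have : height (n + k) <= c * q ^+ (n + k) * a (vertex_len n).+1.
    apply: (le_trans (heightP _)); apply: ler_wpM2l.
      by rewrite mulr_ge0// exprn_ge0// ltW//; case/andP: q01.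
    by apply: seq_of_leq; rewrite /vertex_len; lia.
  have -> : b (n + k).+1%N = b (n + k)%N - c * q ^+ (n + k) by rewrite -[b (n + k)%N]bS; ring.
  move: IH h1; rewrite /level_bump; lra.
apply/ler_addgt0Pr => e e0.
have [N Ne] := tail_small C q01 e0.
have tN : `|rsum s x - psum s (n + N) x| <= e.
  rewrite -lipB (le_trans (lip_norm_eval _ _))//.
  apply: (le_trans (random_sum_tail q01 C0 humpP s (n + N))).
  apply: (le_trans (tail_leq q01 C0 (leq_addl n N))).
  have := tail_ge0 q01 C0 N; lra.
rewrite -(subrKA (psum s (n + N) x)) (le_trans (ler_normD _ _))// addrC.
apply: lerD tN; apply: (le_trans (H N)); rewrite ler_wpM2r ?(ltW (seq_of_gt0 _ _))//.
apply: (@le_trans _ _ (b n)); first by rewrite gerBl.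
rewrite /b ler_wpM2r ?invr_ge0 ?(ltW q1)// ler_piMr//.
by have /andP[? ?] := q01; rewrite exprn_ile1// ltW.
Qed.

Hypothesis a_small : forall e, 0 < e -> exists n, a n < e.
Hypothesis a_half : forall j, (m0 < j)%N -> a j.+1 <= a j / 2.

Let translate (v : Lip a) : set (Lip a) := [set x + v | x in ~` Lock a].

(** At a late level, an isolating choice of the weights beats both the later
    levels and the modulus of continuity, which are of the order of
    [a (vertex_len j).+2]. *)
Let few_bad (v : Lip a) j (s : nat -> nat) :
  5 * (`|v| + tail C q 0 + 1) + 2 * (c / (1 - q)) + 2 <= j.+1%:R ->
  (#|bad_digits nvectors level_bump (translate v) j s| * j.+1
    <= nvectors j)%N.
Proof.
set L := `|v| + tail C q 0 + 1; set t := c / (1 - q) => jbig.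
set n := vertex_len j.
pose F0 (x : Sigma) : R := psum s j x - v x.
pose eps := (5 * L + 2 * t + 2) * a n.+2.
have an := seq_of_gt0 a n.+2.
have t0 : 0 <= t by rewrite divr_ge0// ltW.
have L0 : 0 <= L.
  have := tail_ge0 q01 C0 0; have := normr_ge0 v; rewrite /L; lra.
have eps0 : 0 <= eps by rewrite mulr_ge0 ?(ltW an)//; lra.
have step_eps : (2 ^ n)%:R * eps <= step j.
  rewrite /step /eps -/n mulrA ler_wpM2r ?(ltW an)//.
  rewrite mulrC; apply: ler_pM => //; first lra.
  by rewrite ler_nat leq_exp2l.
have card := @card_not_isolated R n (nweights j) F0 (step j) eps step_eps eps0.
have : (#|bad_digits nvectors level_bump (translate v) j s| <=
    #|[pred X : weights j | `[< ~ isolated n eps (perturbed F0 (step j) X) >]]|)%N.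
  rewrite -(card_imset _ (@enum_val_inj _ {: weights j})).
  apply: subset_leq_card; apply/fintype.subsetP => X /imsetP[d].
  rewrite !inE => -[s' [ds' s's s'j [G nG Gs']]] ->.
  move=> iso; apply: nG.
  have GE : G = rsum s' - v by rewrite -Gs' addrK.
  have psE x : psum s' j.+1 x = psum s j x + bump (enum_val d) x.
    have -> : psum s' j.+1 = psum s' j + level_bump j (s' j).
      by rewrite /partial big_ord_recr.
    rewrite lipD /level_bump s'j vectorE; congr (lip_val _ _ + _).
    by apply: eq_bigr => i _; rewrite s's.
  apply: (@lock_of_isolated R a a_small n _ G (t * a n.+2) L eps _ _ iso).
  - by move=> i ni; apply: a_half; apply: leq_ltn_trans ni; exact: leq_addr.
  - move=> x; have := later_levels s' j.+1 x.
    rewrite psE GE lipB /perturbed /F0 /vertex_len addnS.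
    congr (`|_| <= _); rewrite /= /bump_fun; ring.
  - rewrite GE /L lerD2r (le_trans (lip_normD _ _))// addrC lerD//.
      by rewrite -[lip_norm _]/(`|- v|) normrN.
    have := random_sum_tail q01 C0 humpP s' 0.
    by rewrite /partial big_ord0 subr0.
  - by rewrite /eps; lra.
rewrite -(leq_pmul2r (nweights_gt0 j)) => /leq_trans/(_ card).
by rewrite /nweights mulnCA leq_pmul2l ?expn_gt0.
Qed.

Theorem Lock_prevalent : prevalent (Lock a).
Proof.
have oL := @open_Lock R a.
exists (~` Lock a); split=> //; split.
  by apply: measurableC; exact: borel_open.
exists (law nvectors_gt0 q01 C0 humpP); split; first exact: law_compact.
move=> v; have mT : measurable (translate v : set (borel (Lip a))).
  exact: measurable_translate.
apply: (law_null nvectors_gt0 q01 C0 humpP mT).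
move=> D; pose B := 5 * (`|v| + tail C q 0 + 1) + 2 * (c / (1 - q)) + 2.
pose j := maxn D (Num.truncn B); exists j => s _.
have Bj : B <= j.+1%:R.
  apply: (@le_trans _ _ (Num.truncn B).+1%:R).
    by rewrite ltW// -truncn_le_nat.
  by rewrite ler_nat ltnS leq_maxr.
have := @few_bad v j s Bj; apply: leq_trans.
by rewrite leq_mul2l ltnS leq_maxl orbT.
Qed.

End perturbation.

(** * Growth of the parameters *)

Lemma linear_geometric (R : realType) (q : R) j : 0 < q < 1 ->
  j.+1%:R * q ^+ j <= (1 - q)^-1.
Proof.
move=> /andP[q0 q1]; have q1' : 0 < 1 - q by rewrite subr_gt0.
rewrite -[leRHS]mul1r ler_pdivlMr//.
suff : j.+1%:R * q ^+ j * (1 - q) + q ^+ j.+1 <= 1.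
  by apply: le_trans; rewrite lerDl exprn_ge0// ltW.
elim: j => [|j IH]; first by rewrite expr0 expr1 !mul1r; lra.
apply: le_trans IH; set Q := q ^+ j.+1.
have -> : q ^+ j.+2 = q * Q by rewrite exprS.
have : j.+1%:R * Q * (1 - q) <= j.+1%:R * q ^+ j * (1 - q).
  rewrite ler_wpM2r ?(ltW q1')// ler_wpM2l// /Q exprS ler_piMl ?exprn_ge0 ?(ltW q0)//.
  exact: ltW.
rewrite -[in X in _ -> X]natr1; lra.
Qed.

(** A quadratic factor costs nothing against an exponential with a slightly
    larger base: if [r <= q ^ 3], two of the three factors [q ^ j] absorb the
    two linear factors. *)
Lemma quadratic_geometric (R : realType) (r : R) : 0 < r < 1 ->
  exists q c : R, [/\ 0 < q < 1, 0 <= c &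
    forall j, j.+1%:R ^+ 2 * r ^+ j <= c * q ^+ j].
Proof.
move=> /andP[r0 r1]; pose q := (r + 2) / 3.
have q01 : 0 < q < 1 by apply/andP; rewrite /q; split; lra.
have /andP[q0 q1] := q01.
exists q, ((1 - q)^-1 ^+ 2); split=> [//||j]; first by rewrite sqr_ge0.
(* [1 - q] is a third of [1 - r], so this is Bernoulli's inequality. *)
have rq : r <= q ^+ 3.
  have -> : r = 3 * q - 2 by rewrite /q; field.
  rewrite -subr_ge0 (_ : _ - _ = (q - 1) ^+ 2 * (q + 2)); last by ring.
  by rewrite mulr_ge0 ?sqr_ge0// addr_ge0// ltW.
apply: (@le_trans _ _ (j.+1%:R ^+ 2 * (q ^+ j) ^+ 3)).
  rewrite ler_wpM2l ?sqr_ge0// -exprM mulnC exprM.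
  by apply: lerXn2r; rewrite // nnegrE ?exprn_ge0// ltW.
have -> : j.+1%:R ^+ 2 * (q ^+ j) ^+ 3 = (j.+1%:R * q ^+ j) ^+ 2 * q ^+ j :> R by ring.
rewrite ler_wpM2r ?exprn_ge0 ?(ltW q0)// lerXn2r ?nnegrE//.
- by rewrite mulr_ge0// exprn_ge0// ltW.
- by rewrite invr_ge0 subr_ge0 ltW.
- exact: linear_geometric.
Qed.

(** The metric is then compatible with the product topology. *)
Lemma eventually_halving (R : realType) (a : decr_seq R) n0 :
  (forall j, (n0 <= j)%N -> a j.+1 <= a j / 2) ->
  forall e, 0 < e -> exists n, a n < e.
Proof.
move=> ha e e0.
have H k : a (n0 + k)%N <= a n0 * 2^-1 ^+ k.
  elim: k => [|k IH]; first by rewrite addn0 expr0 mulr1.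
  rewrite addnS (le_trans (ha _ (leq_addr _ _)))// exprSr mulrA.
  by rewrite ler_wpM2r// invr_ge0.
have : (fun k => geometric (a n0) 2^-1 k) @ \oo --> (0 : R).
  by apply: cvg_geometric; rewrite ger0_norm ?invr_ge0//; lra.
move=> /cvgrPdist_lt/(_ e e0)[k _ /(_ k (leqnn k))] /=.
rewrite sub0r normrN => Hk; exists (n0 + k)%N.
exact: le_lt_trans (H k) (le_lt_trans (ler_norm _) Hk).
Qed.

Theorem theorem1p1 (R : realType) (theta : R) (a : decr_seq R)
    (theta_range : 0 < theta < 4^-1)
    (a_ratio : (fun n : nat => a n.+1 / a n) =O_\oo
               (fun n : nat => theta ^+ n)) :
  prevalent [set f : Lip a | PU sigma f] /\ prevalent (Lock a).
Proof.
have /andP[th0 th4] := theta_range.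
have a_gt0 := seq_of_gt0 a.
have [k k0 [n1 _ ratio]] := (eqO_exP _ _ _).1 a_ratio.
have [n2 _ ksmall] : \forall n \near \oo, k * theta ^+ n < 2^-1.
  have : (fun n => geometric k theta n) @ \oo --> (0 : R).
    by apply: cvg_geometric; rewrite gtr0_norm//; lra.
  move=> /cvgrPdist_lt/(_ 2^-1 (ltac:(by [])))/=; apply: filterS => n.
  rewrite sub0r normrN; apply: le_lt_trans; exact: ler_norm.
pose m0 := maxn n1 n2.
have ratio' n : (m0 <= n)%N -> a n.+1 <= k * theta ^+ n * a n.
  move=> m0n; rewrite -ler_pdivrMr//.
  have := ratio n (leq_trans (leq_maxl _ _) m0n).
  by rewrite /= !ger0_norm// ?divr_ge0 ?exprn_ge0// ltW.
have half n : (m0 <= n)%N -> a n.+1 <= a n / 2.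
  move=> m0n; apply: (le_trans (ratio' n m0n)); rewrite mulrC ler_pM2l//.
  by apply/ltW/ksmall; apply: leq_trans m0n; exact: leq_maxr.
have r01 : 0 < 4 * theta < 1.
  by rewrite mulr_gt0//= -ltr_pdivlMl// mulr1.
have /andP[r0 r1] := r01.
have [q [c [q01 c0 qc]]] := quadratic_geometric r01.
have kc0 : 0 <= k * c by rewrite mulr_ge0// ltW.
have a_small := eventually_halving half.
have heightP j : height a m0 j <= k * c * q ^+ j * a (vertex_len m0 j).+1.
  rewrite /height /step /nweights /vertex_len; set n := (m0 + j).+1.
  have -> : (2 ^ n * j.+1)%:R * (j.+1%:R * (2 ^ n)%:R * a n.+1) =
      j.+1%:R ^+ 2 * 4 ^+ n * a n.+1.
    have -> : (4 : R) = 2 * 2 by lra.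
    by rewrite exprMn natrM natrX; ring.
  have m0n : (m0 <= n)%N by rewrite /n; lia.
  apply: (@le_trans _ _ (j.+1%:R ^+ 2 * 4 ^+ n * (k * theta ^+ n * a n))).
    by rewrite ler_wpM2l ?ratio'// mulr_ge0// exprn_ge0.
  have -> : j.+1%:R ^+ 2 * 4 ^+ n * (k * theta ^+ n * a n) =
      k * (j.+1%:R ^+ 2 * (4 * theta) ^+ n) * a n by rewrite exprMn; ring.
  rewrite ler_wpM2r ?(ltW (a_gt0 _))// -mulrA ler_wpM2l ?(ltW k0)//.
  apply: le_trans (qc j); rewrite ler_wpM2l ?sqr_ge0//.
  rewrite /n -addSn exprD ler_piMl ?exprn_ge0 ?(ltW r0)//.
  by rewrite exprn_ile1// ltW.
have LP : prevalent (Lock a).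
  apply: (Lock_prevalent q01 kc0 heightP a_small) => j m0j.
  exact: half (ltnW m0j).
split=> //; have [B [shyB LB]] := LP; exists B; split=> // f nPU.
by apply: LB => /(Lock_PU a_small).
Qed.
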